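(* Let $k_0\in[0,1)$, let $k_0\le\lambda_1\le\lambda_2\le 1$ with $\lambda:=\lambda_1+\lambda_2\in(1,2]$, set $\alpha:=\lambda-1$, and let $\Psi(x,y)=x^{\lambda_1}y^{\lambda_2}+x^{\lambda_2}y^{\lambda_1}$ for $(x,y)\in(0,\infty)^2$. Let $\beta\ge 0$ be a measurable function on $(0,1)$ with $$\int_0^1 z\,\beta(z)\,dz=1\quad\text{and}\quad \int_0^1 z^{k_0}\beta(z)\,dz<\infty,$$ and let $$f(z,x,y)=\frac1x\,\beta\Big(\frac zx\Big)\mathbf 1_{(0,x)}(z)+\frac1y\,\beta\Big(\frac zy\Big)\mathbf 1_{(0,y)}(z),\qquad (x,y)\in(0,\infty)^2 .$$ Let $\eta$ be a self-similar profile (in the sense defined in the context) for the collision-induced breakage equation with collision kernel $\Psi$ and breakage function $f$. If $\beta>0$ a.e. in $(0,1)$, then $\eta$ is strictly positive in $(0,\infty)$ and, for all $x_*\in(0,\infty)$, $$r^2e^{\alpha g(r)}\eta(r)\ge x_*^2e^{\alpha g(x_* )}\eta(x_* ),\qquad r\in(x_*,\infty),$$ where $$g(x):=\max\{M_{\lambda_1}(\eta),M_{\lambda_2}(\eta)\}\left(\frac{x^{\lambda_1}}{\lambda_1}+\frac{x^{\lambda_2}}{\lambda_2}\right),\qquad x\in(0,\infty).$$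
   Context: For $r\in\mathbb R$, $\mathcal S_r:=L^1((0,\infty),x^r dx)$ and $M_r(g):=\int_0^\infty x^r g(x)\,dx$ for $g\in\mathcal S_r$. Let $\mathcal T^1$ be the set of (globally) Lipschitz continuous functions $\varsigma:[0,\infty)\to\mathbb R$ with $\varsigma(0)=0$. Definition (self-similar profile). With $\alpha=\lambda_1+\lambda_2-1$, a self-similar profile for the collision-induced breakage equation with collision kernel $\Psi$ and breakage function $f$ is a function $\eta\ge 0$ a.e. in $(0,\infty)$ such that $\eta\in\mathcal S_{\lambda_1}\cap\mathcal S_{1+\lambda_2}$, $M_1(\eta)=1$, and $$\int_0^\infty[\varsigma(x)-x\varsigma'(x)]\eta(x)\,dx=\frac\alpha2\int_0^\infty\int_0^\infty\Upsilon_\varsigma(x,y)\Psi(x,y)\eta(x)\eta(y)\,dy\,dx$$ for all $\varsigma\in\mathcal T^1$, where $$\Upsilon_\varsigma(x,y):=\int_0^{x+y}\varsigma(z)f(z,x,y)\,dz-\varsigma(x)-\varsigma(y).$$ Functions are identified when equal a.e.; such a profile belongs to $\mathcal C((0,\infty))$, and pointwise statements about $\eta$ refer to its continuous representative. *)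

(* Defs.v *)
From mathcomp Require Import all_boot all_order all_algebra.
From mathcomp Require Import all_classical all_reals all_analysis.
Import Order.TTheory GRing.Theory Num.Theory.
Import numFieldNormedType.Exports.

Set Implicit Arguments.
Unset Strict Implicit.
Unset Printing Implicit Defensive.

Local Open Scope classical_set_scope.
Local Open Scope ring_scope.

Section CollisionInducedBreakage.
Context {R : realType}.
Local Notation mu := (@lebesgue_measure R).

Definition weighted_L1 (r : R) (g : R -> R) : Prop :=
  mu.-integrable `]0, +oo[ (fun x => (x `^ r * g x)%:E).

Definition moment (r : R) (g : R -> R) : R :=
  \int[mu]_(x in `]0, +oo[) (x `^ r * g x).

(* A test function on [0, +oo[ is represented by a total function whose values
   on the negative half-line are unconstrained. *)
Definition test_function (s : R -> R) : Prop :=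
  (exists L : R, L.-lipschitz_(`[0, +oo[) s) /\ s 0 = 0.

Definition breakage_defect (f : R -> R -> R -> R) (s : R -> R) (x y : R) : R :=
  (\int[mu]_(z in `]0, x + y[) (s z * f z x y)) - s x - s y.

(* A test function is differentiable only a.e.; [derive1 s x] takes a fixed
   default value elsewhere, which does not affect the integral. *)
Definition self_similar_profile (lambda1 lambda2 : R) (Psi : R -> R -> R)
    (f : R -> R -> R -> R) (eta : R -> R) : Prop :=
  [/\ {ae mu, forall x, 0 < x -> 0 <= eta x},
      weighted_L1 lambda1 eta /\ weighted_L1 (1 + lambda2) eta,
      moment 1 eta = 1 &
      forall s, test_function s ->
        \int[mu]_(x in `]0, +oo[) ((s x - x * derive1 s x) * eta x) =
        (lambda1 + lambda2 - 1) / 2 *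
        \int[mu]_(x in `]0, +oo[) \int[mu]_(y in `]0, +oo[)
          (breakage_defect f s x y * Psi x y * eta x * eta y)].

Definition collision_kernel (lambda1 lambda2 x y : R) : R :=
  x `^ lambda1 * y `^ lambda2 + x `^ lambda2 * y `^ lambda1.

Definition breakage_function (beta : R -> R) (z x y : R) : R :=
  x^-1 * beta (z / x) * \1_(`]0, x[%classic) z +
  y^-1 * beta (z / y) * \1_(`]0, y[%classic) z.

Definition continuous_representative (eta u : R -> R) : Prop :=
  {within `]0, +oo[, continuous u} /\ {ae mu, forall x, 0 < x -> u x = eta x}.

Definition growth_exponent (lambda1 lambda2 : R) (eta : R -> R) (x : R) : R :=
  Num.max (moment lambda1 eta) (moment lambda2 eta) *
  (x `^ lambda1 / lambda1 + x `^ lambda2 / lambda2).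

End CollisionInducedBreakage.

(* Main.v *)
Require Import Defs.
From mathcomp Require Import all_boot all_order all_algebra.
From mathcomp Require Import all_classical all_reals all_analysis.
From mathcomp Require Import measurable_realfun ring lra.
Import Order.TTheory GRing.Theory Num.Theory.
Import numFieldNormedType.Exports.

(** Notation for the idea: M_l is the moment of order l of eta,
    A(x) = alpha (M_l2 x^l1 + M_l1 x^l2) is the rescaled rate at which a particle of
    size x collides, K(x) = x A(x) eta(x) the mass undergoing collisions, and
    J(z) = z beta(z), a probability density, the mass distribution of the
    daughters relative to their parent.

    Representation.  The breakage function is a term in x plus a term in y and
    the kernel is a symmetric sum of products, so the double integral of the
    weak formulation collapses to a simple integral against A eta.  The test
    function s(x) = x max(0, b - x) satisfies s(x) - x s'(x) = x^2 for x < b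
    and 0 for x > b, and turns the weak formulation into
      int_0^b x^2 eta(x) dx + int K(x) max(0, b - x) dx
        = int int K(x) J(z) max(0, b - x z) dz dx        for all b > 0.
    Since max(0, b - h) is the length of the set of s in (0, b) with h < s,
    Tonelli writes the last two integrals as integrals over s in (0, b) of
    C1(s), the K-mass of parents smaller than s, and C2(s), the mass of
    daughters smaller than s.  Lebesgue differentiation in b then yields
    x^2 eta(x) = F(x) := C2(x) - C1(x) for almost every x
    ([ae_square_weighted_profile]).  Both C1 and C2 are continuous because
    their level sets are null, so F(x) / x^2 is the continuous representative.

    Monotonicity.  F + C1 = C2 is nondecreasing, and C1' = (A(x) / x) F is at
    most alpha g' F.  For fixed r the function I(t) = F(r) + C1(r) - C1(t)
    therefore dominates F on (0, r] and exp(alpha g) I is nondecreasing there;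
    comparing it at s and at r, where I(r) = F(r), gives the claim
    ([gronwall_backward], [growth_monotone]).

    Positivity.  F(x) is the integral over the parents y > x of K(y) times the
    fraction of mass that they send below x, and this fraction is positive when
    beta > 0.  If F(x) = 0, then eta vanishes a.e. above x ([ae_eq0_above]), and
    monotonicity makes F vanish below x; this is absurd for a profile of unit
    mass ([square_weighted_profile_gt0]). *)

Local Open Scope classical_set_scope.
Local Open Scope ring_scope.

Set Implicit Arguments.
Unset Strict Implicit.
Unset Printing Implicit Defensive.

(** * Almost everywhere statements and dilations for Lebesgue measure *)

Lemma ae_lebesgueS (R : realType) (P Q : R -> Prop) :
  (forall x, P x -> Q x) -> {ae @lebesgue_measure R, forall x, P x} ->
  {ae @lebesgue_measure R, forall x, Q x}.
Proof.
by move=> PQ; apply: (@filterS _ _ (ae_filter_ringOfSetsType (@lebesgue_measure R))).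
Qed.

Lemma ae_lebesgueS2 (R : realType) (P Q S : R -> Prop) :
  (forall x, P x -> Q x -> S x) -> {ae @lebesgue_measure R, forall x, P x} ->
  {ae @lebesgue_measure R, forall x, Q x} ->
  {ae @lebesgue_measure R, forall x, S x}.
Proof.
by move=> PQ; apply: (@filterS2 _ _ (ae_filter_ringOfSetsType (@lebesgue_measure R))).
Qed.

(** Lebesgue measure and the suitably scaled push-forward of Lebesgue measure
    by a dilation agree on half-open intervals, hence on all Borel sets. *)
Lemma ge0_integral_dilation (R : realType) (c : R) (h : R -> R) : 0 < c ->
  measurable_fun setT h -> (forall x, 0 <= h x) ->
  (\int[@lebesgue_measure R]_x (c^-1 * h (x / c))%:E =
   \int[@lebesgue_measure R]_x (h x)%:E)%E.
Proof.
move=> c0 mh h0.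
have ci0 : 0 <= c^-1 by rewrite invr_ge0 ltW.
pose f := (fun x => x / c) : measurableTypeR R -> measurableTypeR R.
have mf : measurable_fun setT f by exact: mulrr_measurable.
under eq_integral do rewrite EFinM.
rewrite ge0_integralZl//=; last 2 first.
- by apply/measurable_EFinP; exact: (measurableT_comp mh mf).
- by move=> x _; rewrite lee_fin.
rewrite -[X in integral _ X _](preimage_setT f).
rewrite -(ge0_integral_pushforward mf lebesgue_measure
  (f := fun x => (h x)%:E))//; last 2 first.
- exact/measurable_EFinP.
- by move=> x _; rewrite lee_fin.
rewrite -[c^-1]/((NngNum ci0)%:num) -ge0_integral_mscale//; last 2 first.
- exact/measurable_EFinP.
- by move=> x _; rewrite lee_fin.
apply: eq_measure_integral => A mA _.
symmetry; apply: lebesgue_measure_unique => // _ [[a b]] _ <-.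
transitivity ((c^-1)%:E * lebesgue_measure (f @^-1` `]a, b]))%E; last by [].
rewrite (_ : f @^-1` _ = `]a * c, b * c]%classic); last first.
  by apply/seteqP; split=> x /=; rewrite !in_itv/= ltr_pdivlMr// ler_pdivrMr.
rewrite /= !lebesgue_measure_itv/= !lte_fin ltr_pM2r//.
case: ifP => _; last by rewrite mule0.
by rewrite -!EFinD -EFinM -mulrBl mulrCA mulVf ?mulr1// gt_eqF.
Qed.

(** By Lebesgue differentiation, the zero primitive has derivative [d] almost
    everywhere. *)
Lemma ae_eq0_integral_prefix (R : realType) (d : R -> R) :
  locally_integrable setT d ->
  (forall x : R, 0 < x -> \int[@lebesgue_measure R]_(t in `]0%R, x]) d t = 0) ->
  {ae @lebesgue_measure R, forall x : R, 0 < x -> d x = 0}.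
Proof.
move=> ld d0; have [md _ ldc] := ld.
have id y : (@lebesgue_measure R).-integrable
    [set` Interval (BRight 0) (BRight y)] (EFin \o d).
  have : (@lebesgue_measure R).-integrable `[0, y] (EFin \o d); last first.
    apply: integrableS => //.
    by apply: subset_itvr; rewrite bnd_simp.
  apply/integrableP; split; first by apply/measurable_EFinP; exact: measurable_funS md.
  by apply: ldc => //; exact: segment_compact.
have := FTC1 id ld; apply: ae_lebesgueS.
move=> x H x0; have /H[_ <-] : (BRight 0 < BRight x)%O by rewrite bnd_simp.
rewrite (_ : (fun x => _) = cst 0) ?derive1_cst//.
apply/funext => y; have [/d0//|y0] := ltP 0 y.
by rewrite set_itv_ge ?Rintegral_set0// bnd_simp -leNgt.
Qed.

(** * A backward Gronwall inequality *)

(** The classical argument run from the right end point: with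
    [I t = F r + C r - C t], monotonicity of [F + C] gives [F <= I] on (0, r],
    so [I' = - C' >= - G' I] and [expR G * I] is nondecreasing. Starting from
    the left end point would only produce an estimate in the wrong direction. *)
Lemma gronwall_backward (R : realType) (F C G : R -> R) :
  (forall x : R, 0 < x -> 0 <= F x) ->
  (forall x y : R, 0 < x -> x < y -> F x + C x <= F y + C y) ->
  (forall x : R, 0 < x -> derivable C x 1) ->
  (forall x : R, 0 < x -> derivable G x 1) ->
  (forall x : R, 0 < x -> 0 <= derive1 G x) ->
  (forall x : R, 0 < x -> derive1 C x <= derive1 G x * F x) ->
  forall s r : R, 0 < s -> s < r -> expR (G s) * F s <= expR (G r) * F r.
Proof.
move=> F0 FC dC dG G0 CG s r s0 sr.
pose I t := F r + C r - C t.
have FI (t : R) : 0 < t -> t <= r -> F t <= I t.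
  move=> t0; rewrite le_eqVlt => /predU1P[->|tr]; first by rewrite /I addrK.
  by rewrite /I lerBrDr FC.
have dI (t : R) : 0 < t -> is_derive t 1 I (- derive1 C t).
  move=> t0; have := dC _ t0; rewrite derive1E => /derivableP dCt.
  rewrite /I; apply: is_derive_eq.
  by rewrite add0r mul1r.
have dE (t : R) : 0 < t -> is_derive t 1 (fun t : R => expR (G t))
    (expR (G t) * derive1 G t).
  move=> t0; have := dG _ t0; rewrite derive1E => /derivableP dGt.
  by apply: is_derive_eq; rewrite mulrC.
have dW (t : R) : 0 < t -> is_derive t 1 (fun t : R => expR (G t) * I t)
   (expR (G t) * (derive1 G t * I t - derive1 C t)).
  move=> t0; have := dI _ t0; have := dE _ t0 => ? ?.
  apply: is_derive_eq; rewrite /GRing.scale/=; ring.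
have W : expR (G s) * I s <= expR (G r) * I r.
  apply: (@ger0_derive1_le_cc _ (fun t : R => expR (G t) * I t) s r) => //.
  - move=> t; rewrite in_itv/= => /andP[st _].
    by have [] := dW _ (lt_trans s0 st).
  - move=> t; rewrite in_itv/= => /andP[st tr].
    have t0 := lt_trans s0 st.
    have := dW _ t0 => ?; rewrite derive1E derive_val mulr_ge0 ?expR_ge0//.
    rewrite subr_ge0 (le_trans (CG _ t0))// ler_wpM2l// ?G0// FI// ltW//.
  - apply: derivable_within_continuous => t; rewrite in_itv/= => /andP[st _].
    by have [] := dW _ (lt_le_trans s0 st).
  - by rewrite in_itv/= lexx ltW.
  - by rewrite in_itv/= lexx ltW.
  - exact: ltW.
rewrite (le_trans (ler_wpM2l (expR_ge0 _) (FI _ s0 (ltW sr))))//.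
by rewrite (le_trans W)// /I addrK.
Qed.

(** * Integrals over sublevel sets *)

Definition sublevel_integral d (T : measurableType d) (R : realType)
    (m : {measure set T -> \bar R}) (k h : T -> R) (s : R) : R :=
  \int[m]_t (if h t < s then k t else 0).

(** The length of [{s in (0, b) | h t < s}] is [max 0 (b - h t)] as soon as
    [h t >= 0]; the rest is Tonelli. The sign condition on [h] is only imposed
    where [k] charges, so that functions extended by zero are covered. *)
Lemma layer_cake d (T : measurableType d) (R : realType)
    (m : {sigma_finite_measure set T -> \bar R}) (k h : T -> R) (b : R) :
  measurable_fun setT k -> measurable_fun setT h ->
  (forall t, 0 <= k t) -> (forall t, k t != 0 -> 0 <= h t) ->
  (\int[m]_t (k t * Num.max 0 (b - h t))%:E =
   \int[@lebesgue_measure R]_(s in `]0%R, b[)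
     \int[m]_t (if (h t < s)%R then k t else 0%R)%:E)%E.
Proof.
move=> mk mh k0 kh.
pose f (ts : T * measurableTypeR R) : \bar R :=
  (if (h ts.1 < ts.2) && (0 < ts.2 < b) then k ts.1 else 0)%:E.
have f0 ts : (0 <= f ts)%E by rewrite /f lee_fin; case: ifP.
have mf : measurable_fun setT f.
  apply/measurable_EFinP; apply: measurable_fun_ifT => //=; last first.
    exact: measurableT_comp.
  apply: measurable_and; first apply: measurable_fun_ltr => //.
    exact: measurableT_comp.
  by apply: measurable_and; apply: measurable_fun_ltr.
transitivity (\int[@lebesgue_measure R]_s \int[m]_t f (t, s))%E; last first.
  rewrite [RHS]integral_mkcond; apply: eq_integral => s _.
  rewrite patchE; case: ifPn => [|]; rewrite ?inE/= ?notin_setE/= in_itv/=.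
    by move=> sb; apply: eq_integral => t _; rewrite /f/= sb andbT.
  move=> /negP/negbTE sb; apply: integral0_eq => t _.
  by rewrite /f/= sb andbF.
rewrite -(fubini_tonelli (m1 := m) (m2 := lebesgue_measure) f)//.
apply: eq_integral => t _.
have [kt0|kt0] := eqVneq (k t) 0.
  by rewrite kt0 mul0r integral0_eq// => s _; rewrite /f/= kt0 if_same.
have ht0 := kh _ kt0.
under eq_integral => s _.
  rewrite (_ : f (t, s) = (k t)%:E * (\1_(`]h t, b[%classic) s)%:E)%E; last first.
    rewrite /f/= indicE; case: ifPn => [/andP[hs /andP[s0 sb]]|].
      by rewrite mem_set ?mule1//= in_itv/= hs.
    move=> H; rewrite memNset ?mule0//=; rewrite in_itv/= => /andP[hs sb].
    by move: H; rewrite hs sb (le_lt_trans ht0 hs).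
  over.
rewrite ge0_integralZl//=; last 2 first.
- by apply/measurable_EFinP; exact: measurable_indic.
- by rewrite lee_fin.
rewrite integral_indic//= setIT lebesgue_measure_itv/= lte_fin.
rewrite EFinM; congr (_ * _)%E.
case: ltP => hb; first by rewrite -EFinD max_r// subr_ge0 ltW.
by rewrite max_l// subr_le0.
Qed.

(** Dominated convergence: the integrands converge off the level set of [h]
    at [s]. *)
Lemma sublevel_integral_continuous d (T : measurableType d) (R : realType)
    (m : {measure set T -> \bar R}) (k h : T -> R) (s : R) :
  m.-integrable setT (EFin \o k) -> measurable_fun setT h ->
  m (h @^-1` [set s]) = 0%E ->
  {for s, continuous (sublevel_integral m k h)}.
Proof.
move=> ik mh hs0.
have mk : measurable_fun setT k by apply/measurable_EFinP; case/integrableP : ik.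
apply/(@cvg_nbhsP _ R^o) => w ws.
have mF r : measurable_fun setT (fun t => (if h t < r then k t else 0)%:E).
  apply/measurable_EFinP; apply: measurable_fun_ifT => //=.
  exact: measurable_fun_ltr.
have fcvg : {ae m, forall t, setT t ->
    (if h t < w n then k t else 0)%:E @[n --> \oo] -->
    (if h t < s then k t else 0)%:E}.
  exists (h @^-1` [set s]); split => //.
    by rewrite -[X in measurable X]setTI; apply: mh.
  move=> t /= Nt; apply: contrapT => hts; apply: Nt => _.
  apply: cvg_EFin; first exact: nearW.
  apply: (@cvg_near_cst _ R^o).
  have [hlt|hgt] : h t < s \/ s < h t.
    by case: (ltgtP (h t) s) => [||/hts//]; [left|right].
  - near=> n; rewrite hlt /=.
    have -> // : h t < w n by near: n; exact: (cvgr_gt s).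
  - near=> n; rewrite [h t < s]ltNge (ltW hgt) /=.
    have -> // : h t < w n = false.
    by apply/negbTE; rewrite -leNgt; apply: ltW; near: n; exact: (cvgr_lt s).
have fdom : {ae m, forall t n, setT t ->
    (`|(if h t < w n then k t else 0)%:E| <= `|k t|%:E)%E}.
  by apply: aeW => t n _ /=; case: ifPn => _; rewrite lee_fin ?normr0.
have [fint _ cvF] := dominated_convergence measurableT (fun n => mF (w n)) (mF s)
  fcvg (integrable_norm ik) fdom.
rewrite /sublevel_integral /Rintegral; apply: fine_cvg; rewrite fineK; first exact: cvF.
exact: integrable_fin_num.
Unshelve. all: by end_near. Qed.

Section sublevel_integral_theory.
Context d (T : measurableType d) (R : realType).
Variables (m : {measure set T -> \bar R}) (k h : T -> R).
Hypotheses (mh : measurable_fun setT h) (k0 : forall t, 0 <= k t)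
  (ik : m.-integrable setT (EFin \o k)).

Let mk : measurable_fun setT k.
Proof. by apply/measurable_EFinP; case/integrableP : ik. Qed.

Lemma integrable_sublevel_integral s :
  m.-integrable setT (EFin \o (fun t => if h t < s then k t else 0)).
Proof.
apply: (le_integrable measurableT _ _ ik) => [|t _ /=].
  apply/measurable_EFinP; apply: measurable_fun_ifT => //=.
  exact: measurable_fun_ltr.
by case: ifP => // _; rewrite normr0 lee_fin.
Qed.

Lemma EFin_sublevel_integral s :
  ((sublevel_integral m k h s)%:E = \int[m]_t (if (h t < s)%R then k t else 0%R)%:E)%E.
Proof.
rewrite /sublevel_integral /Rintegral fineK//.
exact: (integrable_fin_num measurableT (integrable_sublevel_integral s)).
Qed.

Lemma sublevel_integral_le s s' : s <= s' ->
  sublevel_integral m k h s <= sublevel_integral m k h s'.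
Proof.
move=> ss'; apply: le_Rintegral => //; try exact: integrable_sublevel_integral.
move=> t _; case: ifP => hs; last by case: ifP.
by rewrite (lt_le_trans hs ss').
Qed.

Lemma sublevel_integral_ge0 s : 0 <= sublevel_integral m k h s.
Proof. by apply: Rintegral_ge0 => t _; case: ifP. Qed.

Lemma sublevel_integral_le_total s : sublevel_integral m k h s <= \int[m]_t k t.
Proof.
apply: le_Rintegral => //; first exact: integrable_sublevel_integral.
by move=> t _; case: ifP.
Qed.

Lemma measurable_sublevel_integral : measurable_fun setT (sublevel_integral m k h).
Proof.
by apply: nondecreasing_measurable => // s s' ss'; exact: sublevel_integral_le.
Qed.

Lemma locally_integrable_sublevel_integral :
  locally_integrable setT (sublevel_integral m k h).
Proof.
split; [exact: measurable_sublevel_integral|exact: openT|move=> A _ cA].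
have mA : measurable A by exact: compact_measurable.
apply: (@le_lt_trans _ _
  (\int[lebesgue_measure]_(x in A) (cst (\int[m]_t k t)%:E x))%E).
  apply: ge0_le_integral => //=.
  - apply/measurable_EFinP; apply: measurableT_comp => //.
    exact: measurable_funTS measurable_sublevel_integral.
  - move=> x _; rewrite lee_fin ger0_norm ?sublevel_integral_ge0//.
    exact: sublevel_integral_le_total.
rewrite integral_cst// lte_mul_pinfty//; last exact: compact_finite_measure.
by rewrite lee_fin Rintegral_ge0.
Qed.

End sublevel_integral_theory.

Lemma layer_cake_sublevel_integral d (T : measurableType d) (R : realType)
    (m : {sigma_finite_measure set T -> \bar R}) (k h : T -> R) (b : R) :
  m.-integrable setT (EFin \o k) -> measurable_fun setT h ->
  (forall t, 0 <= k t) -> (forall t, k t != 0 -> 0 <= h t) ->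
  (\int[m]_t (k t * Num.max 0 (b - h t))%:E =
   \int[@lebesgue_measure R]_(s in `]0%R, b[) (sublevel_integral m k h s)%:E)%E.
Proof.
move=> ik mh k0 kh; rewrite layer_cake//.
  by apply: eq_integral => s _; rewrite EFin_sublevel_integral.
by apply/measurable_EFinP; case/integrableP : ik.
Qed.

(** * Mass balance between colliding particles and their daughters *)

Definition mass_below (R : realType) (K : R -> R) : R -> R :=
  sublevel_integral (@lebesgue_measure R) K id.

(** A parent of size [x] is replaced by daughters of size [x z], where the mass
    fraction of ratio [z] has density [J]; the pair [(x, z)] counts when the
    daughter is smaller than [s]. *)
Definition fragment_mass_below (R : realType) (K J : R -> R) : R -> R :=
  sublevel_integral (@lebesgue_measure R \x @lebesgue_measure R)%E
    (fun p => K p.1 * J p.2) (fun p => p.1 * p.2).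

Section fragmentation_profile.
Context (R : realType).
Local Notation mu := (@lebesgue_measure R).
Variables (K J w : R -> R).
Hypotheses (K0 : forall x, 0 <= K x) (Kpos : forall x, K x != 0 -> 0 < x)
  (iK : mu.-integrable setT (EFin \o K)).
Hypotheses (J0 : forall z, 0 <= J z) (Jitv : forall z, J z != 0 -> 0 < z < 1)
  (mJ : measurable_fun setT J) (J1 : (\int[mu]_z (J z)%:E = 1)%E).
Hypotheses (w0 : forall x, 0 <= w x) (wpos : forall x, w x != 0 -> 0 < x)
  (mw : measurable_fun setT w).
Hypothesis weak : forall b : R, 0 < b ->
  (\int[mu]_x (w x * (x < b)%R%:R)%:E + \int[mu]_x (K x * Num.max 0 (b - x))%:E =
   \int[mu]_x \int[mu]_z (K x * J z * Num.max 0 (b - x * z))%:E)%E.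

Let mK : measurable_fun setT K.
Proof. by apply/measurable_EFinP; case/integrableP : iK. Qed.

Let KJ (p : measurableTypeR R * measurableTypeR R) := K p.1 * J p.2.
Let hKJ (p : measurableTypeR R * measurableTypeR R) : R := p.1 * p.2.
Let mKJ : measurable_fun setT KJ.
Proof. by apply: measurable_funM; apply: measurableT_comp. Qed.
Let mhKJ : measurable_fun setT hKJ.
Proof. exact: measurable_funM. Qed.
Let KJ0 p : 0 <= KJ p. Proof. by rewrite mulr_ge0. Qed.
Let KJpos p : KJ p != 0 -> 0 <= hKJ p.
Proof.
rewrite mulf_eq0 negb_or => /andP[/Kpos ? /Jitv/andP[? _]].
by rewrite mulr_ge0// ltW.
Qed.

Lemma integrable_KJ : ((mu \x mu)%E).-integrable setT (EFin \o KJ).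
Proof.
apply/integrableP; split; first exact/measurable_EFinP.
rewrite (eq_integral (EFin \o KJ)); last first.
  by move=> p _ /=; rewrite ger0_norm.
rewrite fubini_tonelli1//=; last exact/measurable_EFinP.
have -> : fubini_F mu (EFin \o KJ) = EFin \o K.
  apply/funext => x; rewrite /fubini_F/= /KJ/=.
  under eq_integral do rewrite EFinM.
  rewrite ge0_integralZl//=; last 3 first.
  - exact/measurable_EFinP.
  - by move=> z _; rewrite lee_fin.
  - by rewrite lee_fin.
  by rewrite J1 mule1.
have /integrableP[_] := iK.
by under eq_integral do rewrite /= ger0_norm//.
Qed.

Lemma mass_below_continuous (s : R) : {for s, continuous (mass_below K)}.
Proof.
apply: sublevel_integral_continuous => //.
by rewrite preimage_id; exact: lebesgue_measure_set1.
Qed.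

(** For each [x <> 0] only the ratio [z = s / x] yields a daughter of size
    exactly [s], so the hyperbola [x z = s] is null for the product measure. *)
Lemma fragment_mass_below_continuous (s : R) : 0 < s ->
  {for s, continuous (fragment_mass_below K J)}.
Proof.
move=> s0; apply: sublevel_integral_continuous => //; first exact: integrable_KJ.
rewrite /= /product_measure1/=; apply: integral0_eq => x _.
have [->|x0] := eqVneq x 0.
  rewrite (_ : xsection _ _ = set0) ?measure0//.
  apply/seteqP; split=> z //; rewrite /xsection/= inE/= /hKJ/= mul0r => s0'.
  by move: s0; rewrite -s0' ltxx.
rewrite (_ : xsection _ _ = [set s / x])//; first exact: lebesgue_measure_set1.
apply/seteqP; split=> z; rewrite /xsection/= inE/= /hKJ/=.
  by move=> <-; rewrite mulrAC mulfV// mul1r.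
by move=> ->; rewrite mulrCA mulfV// mulr1.
Qed.

Lemma fragment_mass_belowE (s : R) :
  ((fragment_mass_below K J s)%:E =
   \int[mu]_x \int[mu]_z (if (x * z < s)%R then K x * J z else 0)%:E)%E.
Proof.
rewrite /fragment_mass_below EFin_sublevel_integral//; last exact: integrable_KJ.
apply: (fubini_tonelli1 (m1 := mu) (m2 := mu)
  (fun p => (if hKJ p < s then KJ p else 0)%:E)).
  apply/measurable_EFinP; apply: measurable_fun_ifT => //=.
  exact: measurable_fun_ltr.
by move=> p; case: ifP; rewrite lee_fin.
Qed.

(** The weak equation says that two primitives agree at [b]; the layer-cake
    formula identifies their densities. *)
Lemma mass_balance (b : R) : 0 < b ->
  (\int[mu]_(x in `]0%R, b[) (w x)%:E + \int[mu]_(x in `]0%R, b[) (mass_below K x)%:E =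
   \int[mu]_(x in `]0%R, b[) (fragment_mass_below K J x)%:E)%E.
Proof.
move=> b0; have := weak b0.
have -> : (\int[mu]_x (K x * Num.max 0 (b - x))%:E =
    \int[mu]_(x in `]0%R, b[) (mass_below K x)%:E)%E.
  have mid : measurable_fun setT (id : R -> R) by [].
  exact: (layer_cake_sublevel_integral b iK mid K0 (fun x Kx => ltW (Kpos Kx))).
have -> : (\int[mu]_x \int[mu]_z (K x * J z * Num.max 0 (b - x * z))%:E =
    \int[mu]_(s in `]0%R, b[) (fragment_mass_below K J s)%:E)%E.
  (* The layer-cake formula is applied to [z] for fixed [x]; Tonelli then
     exchanges [x] with the level [s], which requires the inner integral [G] to
     be jointly measurable. *)
  pose G (q : measurableTypeR R * measurableTypeR R) : \bar R :=
    (\int[mu]_z (if [&& q.1 * z < q.2, 0 < q.2 & q.2 < b]%R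
                then K q.1 * J z else 0%R)%:E)%E.
  have G0 q : (0 <= G q)%E.
    by apply: integral_ge0 => z _; case: ifP => _; rewrite lee_fin// mulr_ge0.
  have mG : measurable_fun setT G.
    apply: (measurable_fun_fubini_tonelli_F (m2 := mu)
      (fun p : (measurableTypeR R * measurableTypeR R) * measurableTypeR R =>
        (if [&& p.1.1 * p.2 < p.1.2, 0 < p.1.2 & p.1.2 < b]%R
         then K p.1.1 * J p.2 else 0%R)%:E)).
      have m11 : measurable_fun setT
          (fun p : (measurableTypeR R * measurableTypeR R) * measurableTypeR R => p.1.1).
        exact: measurableT_comp.
      have m12 : measurable_fun setT
          (fun p : (measurableTypeR R * measurableTypeR R) * measurableTypeR R => p.1.2).
        exact: measurableT_comp.
      apply/measurable_EFinP; apply: measurable_fun_ifT => //=; last first.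
        by apply: measurable_funM; exact: measurableT_comp.
      apply: measurable_and; first apply: measurable_fun_ltr => //.
        exact: measurable_funM.
      by apply: measurable_and; exact: measurable_fun_ltr.
    by move=> p; case: ifP => _; rewrite lee_fin// mulr_ge0.
  transitivity (\int[mu]_x \int[mu]_s G (x, s))%E.
    apply: eq_integral => x _.
    have -> := @layer_cake _ _ R mu (fun z => K x * J z) (fun z => x * z) b.
    - rewrite integral_mkcond; apply: eq_integral => s _.
      rewrite patchE /G/=; case: ifPn; rewrite ?inE/= ?notin_setE/= in_itv/=.
        by move=> sb; apply: eq_integral => z _; rewrite sb andbT.
      move=> /negP/negbTE sb; rewrite integral0_eq// => z _.
      by rewrite sb andbF.
    - exact: measurable_funM.
    - exact: mulrl_measurable.
    - by move=> z; rewrite mulr_ge0.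
    - by move=> z; exact: (@KJpos (x, z)).
  rewrite (fubini_tonelli (m1 := mu) (m2 := mu) G)//.
  rewrite [RHS]integral_mkcond; apply: eq_integral => s _.
  rewrite patchE /G/=; case: ifPn; rewrite ?inE/= ?notin_setE/= in_itv/=.
    move=> sb; rewrite fragment_mass_belowE; apply: eq_integral => x _.
    by apply: eq_integral => z _; rewrite sb andbT.
  move=> /negP/negbTE sb; rewrite integral0_eq// => x _.
  by rewrite integral0_eq// => z _; rewrite sb andbF.
move=> <-; congr (_ + _)%E.
rewrite integral_mkcond; apply: eq_integral => x _.
rewrite patchE; case: ifPn; rewrite ?inE/= ?notin_setE/= in_itv/=.
  by move=> /andP[_ ->]; rewrite mulr1.
have [->|/wpos x0] := eqVneq (w x) 0; first by rewrite mul0r.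
by rewrite x0/= => /negP/negbTE ->; rewrite mulr0.
Qed.

Lemma measurable_fragments_below (s : R) : measurable_fun setT
  (fun x : R => \int[mu]_z (if (x * z < s)%R then J z else 0%R)%:E)%E.
Proof.
apply: (measurable_fun_fubini_tonelli_F (m2 := mu)
  (fun p : measurableTypeR R * measurableTypeR R =>
    (if hKJ p < s then J p.2 else 0)%:E)).
  apply/measurable_EFinP; apply: measurable_fun_ifT => //=.
    exact: measurable_fun_ltr.
  exact: measurableT_comp.
by move=> p; case: ifP; rewrite lee_fin.
Qed.

(** Parents smaller than [s] send all their mass below [s], because daughters
    are smaller than their parent. The excess of [fragment_mass_below] over
    [mass_below] thus comes from the larger parents alone, which gives both its
    sign and the case of equality. *)
Lemma fragment_massB (s : R) : 0 < s ->
  ((fragment_mass_below K J s)%:E = (mass_below K s)%:E +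
    \int[mu]_x ((if (x < s)%R then 0%R else K x)%:E *
      \int[mu]_z (if (x * z < s)%R then J z else 0%R)%:E))%E.
Proof.
move=> s0; rewrite fragment_mass_belowE EFin_sublevel_integral//.
have mJs x : measurable_fun setT (fun z : R => (if x * z < s then J z else 0)%:E).
  apply/measurable_EFinP; apply: measurable_fun_ifT => //=.
  by apply: measurable_fun_ltr => //; exact: mulrl_measurable.
have Js0 x : (0 <= \int[mu]_z (if (x * z < s)%R then J z else 0%R)%:E)%E.
  by apply: integral_ge0 => z _; case: ifP; rewrite lee_fin.
have mI := measurable_fragments_below s.
rewrite -ge0_integralD//=; last 4 first.
- by move=> x _; case: ifP; rewrite lee_fin.
- apply/measurable_EFinP; apply: measurable_fun_ifT => //=.
  exact: measurable_fun_ltr.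
- by move=> x _; apply: mule_ge0 => //; case: ifP; rewrite lee_fin.
- apply: emeasurable_funM => //.
  apply/measurable_EFinP; apply: measurable_fun_ifT => //=.
  exact: measurable_fun_ltr.
apply: eq_integral => x _.
transitivity ((K x)%:E * \int[mu]_z (if (x * z < s)%R then J z else 0%R)%:E)%E.
  rewrite -ge0_integralZl//=; last 3 first.
  - exact: mJs.
  - by move=> z _; case: ifP; rewrite lee_fin.
  - by rewrite lee_fin.
  by apply: eq_integral => z _; rewrite -EFinM; case: ifP; rewrite ?mulr0.
case: (ltP x s) => xs; last by rewrite add0e.
rewrite mul0e adde0.
have [->|/Kpos x0] := eqVneq (K x) 0; first by rewrite mul0e.
rewrite -[RHS]mule1 -J1; congr (_ * _)%E.
apply: eq_integral => z _; case: ifPn => //; rewrite -leNgt => sxz.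
have [->//|/Jitv/andP[_ z1]] := eqVneq (J z) 0.
have : x * z < s by rewrite (lt_trans _ xs)// gtr_pMr.
by rewrite ltNge sxz.
Qed.

Lemma mass_below_le_fragment (s : R) : 0 < s ->
  mass_below K s <= fragment_mass_below K J s.
Proof.
move=> s0; rewrite -lee_fin fragment_massB// leeDl//.
apply: integral_ge0 => x _; apply: mule_ge0; first by case: ifP; rewrite lee_fin.
by apply: integral_ge0 => z _; case: ifP; rewrite lee_fin.
Qed.

Lemma locally_integrable_mass_below : locally_integrable setT (mass_below K).
Proof. exact: locally_integrable_sublevel_integral. Qed.

Lemma locally_integrable_fragment_mass_below :
  locally_integrable setT (fragment_mass_below K J).
Proof. exact: (locally_integrable_sublevel_integral mhKJ KJ0 integrable_KJ). Qed.

Lemma fragment_mass_below_le (s s' : R) : s <= s' ->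
  fragment_mass_below K J s <= fragment_mass_below K J s'.
Proof. exact: (sublevel_integral_le mhKJ KJ0 integrable_KJ). Qed.

Lemma ae_profileE : {ae mu, forall x : R, 0 < x ->
  w x = fragment_mass_below K J x - mass_below K x}.
Proof.
pose c1 := mass_below K; pose c2 := fragment_mass_below K J.
have lc1 : locally_integrable setT c1 by exact: locally_integrable_mass_below.
have lc2 : locally_integrable setT c2 by exact: locally_integrable_fragment_mass_below.
have lci (c : R -> R) (b : R) : locally_integrable setT c ->
    mu.-integrable `]0, b] (EFin \o c).
  move=> [mc _ lc]; apply: (@integrableS _ _ _ mu `[0, b]) => //.
    by apply: subset_itvr; rewrite bnd_simp.
  apply/integrableP; split; first by apply/measurable_EFinP; exact: measurable_funS mc.
  by apply: lc => //; exact: segment_compact.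
have c10 x : 0 <= c1 x by exact: sublevel_integral_ge0.
have c20 x : 0 <= c2 x by exact: sublevel_integral_ge0.
have bal b : 0 < b -> (\int[mu]_(x in `]0%R, b]) (w x)%:E +
    \int[mu]_(x in `]0%R, b]) (c1 x)%:E = \int[mu]_(x in `]0%R, b]) (c2 x)%:E)%E.
  move=> b0; have := mass_balance b0.
  rewrite !integral_itv_bndo_bndc//; apply/measurable_EFinP;
    apply: measurable_funTS => //.
  - by case: lc2.
  - by case: lc1.
have lw : locally_integrable setT w.
  split => //; first exact: openT.
  move=> A _ cA; have mA : measurable A by exact: compact_measurable.
  have /compact_bounded[M [_ AM]] := cA.
  pose b := `|M| + 1.
  have b0 : 0 < b by rewrite ltr_wpDl.
  (* On a bounded set, the mass balance bounds the integral of [w] by that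
     of the bounded function [c2]. *)
  have Aw x : A x -> w x != 0 -> x \in `]0, b].
    move=> Ax /wpos x0; rewrite in_itv/= x0/=.
    by rewrite (le_trans (ler_norm x))// AM// /b ltr_pwDr// ler_norm.
  apply: (@le_lt_trans _ _ (\int[mu]_(x in `]0%R, b]) (c2 x)%:E)%E).
    rewrite -bal//.
    apply: (@le_trans _ _ (\int[mu]_(x in `]0%R, b]) (w x)%:E)%E); last first.
      by rewrite leeDl//; apply: integral_ge0 => x _; rewrite lee_fin.
    rewrite [leLHS]integral_mkcond [leRHS]integral_mkcond.
    apply: ge0_le_integral => //=.
    - by move=> x _; rewrite patchE; case: ifP.
    - apply: (measurable_restrictT _ _).1 => //; apply/measurable_EFinP.
      by apply: measurableT_comp => //; exact: measurable_funTS.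
    - apply: (measurable_restrictT _ _).1 => //; apply/measurable_EFinP.
      exact: measurable_funTS.
    move=> x _; rewrite !patchE; case: ifPn => [/set_mem Ax|_]; last first.
      by case: ifP => // _; rewrite lee_fin.
    have [w00|wx] := eqVneq (w x) 0; first by rewrite w00 normr0; case: ifP.
    by rewrite mem_set ?ger0_norm//=; exact: Aw.
  have /integrableP[_] := lci _ b lc2.
  by under eq_integral do rewrite /= ger0_norm//.
have ld : locally_integrable setT ((w \+ c1) \- c2)%R.
  by apply: locally_integrableB => //; exact: locally_integrableD.
have := ae_eq0_integral_prefix ld _.
move=> /(_ _)/ae_lebesgueS; apply.
  by move=> x H /H /= /subr0_eq wc; rewrite -[RHS]/(c2 x - c1 x) -wc addrK.
move=> b b0.
have iw := lci _ b lw; have i1 := lci _ b lc1; have i2 := lci _ b lc2.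
rewrite RintegralB//; last exact: (lci _ b (locally_integrableD lw lc1)).
rewrite RintegralD//; apply/eqP; rewrite subr_eq0; apply/eqP.
rewrite /Rintegral -fineD; last 2 first.
- exact: (integrable_fin_num _ iw).
- exact: (integrable_fin_num _ i1).
by congr fine; exact: bal.
Qed.

(** A positive [J] charges every subinterval of (0, 1), so a parent of size at
    least [s] sends a positive fraction of its mass below [s]; the excess in
    [fragment_massB] can then only vanish if there is no such parent. *)
Lemma ae_eq0_above (s : R) : {ae mu, forall z : R, 0 < z < 1 -> 0 < J z} ->
  0 < s -> fragment_mass_below K J s = mass_below K s ->
  {ae mu, forall x : R, s <= x -> K x = 0}.
Proof.
move=> Jgt0 s0 Fs; have := fragment_massB s0; rewrite Fs.
pose Js (x : R) := (\int[mu]_z (if (x * z < s)%R then J z else 0%R)%:E)%E.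
have Js0 x : (0 <= Js x)%E.
  by apply: integral_ge0 => z _; case: ifP; rewrite lee_fin.
have mJs : measurable_fun setT Js by exact: measurable_fragments_below.
pose f (x : R) : \bar R := ((if (x < s)%R then 0%R else K x)%:E * Js x)%E.
have f0 x : (0 <= f x)%E by apply: mule_ge0 => //; case: ifP; rewrite lee_fin.
have mf : measurable_fun setT f.
  apply: emeasurable_funM => //.
  apply/measurable_EFinP; apply: measurable_fun_ifT => //=.
  exact: measurable_fun_ltr.
move=> massB.
have If0 : (\int[mu]_x f x = 0)%E.
  move: massB; rewrite -[X in (_ + X)%E]/(\int[mu]_x f x)%E.
  case: (\int[mu]_x f x)%E => [r||]// [].
  by rewrite -[X in X = _]addr0 => /addrI <-.
have /(ae_eq_integral_abs mu measurableT mf) : (\int[mu]_x `|f x| = 0)%E.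
  by rewrite -[RHS]If0; apply: eq_integral => x _; rewrite gee0_abs.
apply: ae_lebesgueS => x /(_ I)/= fx sx.
have x0 : 0 < x by exact: lt_le_trans sx.
move: fx; rewrite /f ltNge sx/= => /eqP; rewrite mule_eq0 => /orP[/eqP[]//|/eqP Jsx].
exfalso; pose j (z : R) := if x * z < s then J z else 0.
have mj : measurable_fun setT (EFin \o j).
  apply/measurable_EFinP; apply: measurable_fun_ifT => //=.
  by apply: measurable_fun_ltr => //; exact: mulrl_measurable.
have /(ae_eq_integral_abs mu measurableT mj) : (\int[mu]_z `|(EFin \o j) z| = 0)%E.
  rewrite -[RHS]Jsx; apply: eq_integral => z _; rewrite gee0_abs//= /j.
  by case: ifP; rewrite lee_fin.
move=> j0.
have : {ae mu, forall z : R, ~ `]0, s / x[%classic z}.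
  apply: ae_lebesgueS2 j0 Jgt0 => z /(_ I) /=.
  rewrite /j in_itv/= => jz Jz /andP[z0 zsx].
  have xzs : x * z < s by rewrite mulrC -ltr_pdivlMr.
  have z1 : z < 1 by rewrite (lt_le_trans zsx)// ler_pdivrMr// mul1r.
  by have := Jz (introT andP (conj z0 z1)); case: jz; rewrite xzs => ->; rewrite ltxx.
move=> [N [mN N0 subN]].
have : (mu `]0%R, (s / x)%R[ <= mu N)%E.
  by apply: le_measure; rewrite ?inE// => z zs; apply: subN => /=; exact.
rewrite N0 lebesgue_measure_itv/= lte_fin divr_gt0//.
by rewrite sube0 lee_fin leNgt divr_gt0.
Qed.

End fragmentation_profile.

(** * Wedge test functions and the daughters of one particle *)

(** Among the functions [x * phi x], the weak formulation only sees the
    derivative of [phi]; [phi = max 0 (b - .)] has derivative minus the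
    indicator of (0, b), which localises the equation below [b]. *)
Definition wedge (R : realType) (b x : R) : R := x * Num.max 0 (b - x).

Lemma wedge_lt (R : realType) (b x : R) : x < b -> wedge b x = x * (b - x).
Proof. by move=> xb; rewrite /wedge max_r// subr_ge0 ltW. Qed.

Lemma wedge_ge (R : realType) (b x : R) : b <= x -> wedge b x = 0.
Proof. by move=> xb; rewrite /wedge max_l ?mulr0// subr_le0. Qed.

(** For x <= y < b the difference factors as (x - y) (b - x - y), and
    |b - x - y| <= b since 0 <= x + y <= 2 b. *)
Lemma test_function_wedge (R : realType) (b : R) : test_function (wedge b).
Proof.
split; last by rewrite /wedge mul0r.
exists `|b|.
suff lip (x y : R) : 0 <= x -> x <= y -> `|wedge b x - wedge b y| <= `|b| * `|x - y|.
  move=> [x y] /= [/=]; rewrite !in_itv/= !andbT => x0 y0.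
  have [xy|/ltW yx] := leP x y; first exact: lip.
  by rewrite distrC [`|x - y|]distrC; exact: lip.
move=> x0 xy; rewrite [`|x - y|]distrC (ger0_norm (_ : 0 <= y - x)) ?subr_ge0//.
have [yb|yb] := ltP y b.
  rewrite (wedge_lt yb) wedge_lt; last exact: le_lt_trans yb.
  rewrite (_ : _ - _ = (x - y) * (b - x - y)); last by ring.
  rewrite normrM distrC (ger0_norm (_ : 0 <= y - x)) ?subr_ge0// mulrC.
  have b0 : 0 <= b by lra.
  rewrite ler_wpM2r ?subr_ge0// (ger0_norm b0).
  by rewrite ler_norml; apply/andP; split; lra.
rewrite (wedge_ge yb) subr0.
have [xb|xb] := ltP x b; last by rewrite wedge_ge// normr0 mulr_ge0// subr_ge0.
have b0 : 0 <= b by lra.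
rewrite wedge_lt// (ger0_norm b0) ger0_norm; last by rewrite mulr_ge0//; lra.
by apply: ler_pM => //; lra.
Qed.

Lemma wedge_flux (R : realType) (b x : R) : x != b ->
  wedge b x - x * derive1 (wedge b) x = x ^+ 2 * (x < b)%R%:R.
Proof.
move=> xb.
have [x_lt|x_gt] : x < b \/ b < x.
  by case: (ltgtP x b) xb => // ?; [left|right].
- rewrite x_lt wedge_lt// mulr1 derive1E.
  have -> : 'D_1 (wedge b) x = 'D_1 (fun x : R => x * (b - x)) x.
    apply: near_eq_derive.
    by near=> y; rewrite wedge_lt//; near: y; exact: lt_nbhsl.
  have -> : 'D_1 (fun x : R => x * (b - x)) x = b - x - x.
    by apply: derive_val; apply: is_derive_eq; rewrite /GRing.scale/=; ring.
  ring.
- rewrite ltNge (ltW x_gt) mulr0 wedge_ge; last exact: ltW.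
  rewrite derive1E.
  have -> : 'D_1 (wedge b) x = 'D_1 (cst (0:R)) x.
    apply: near_eq_derive.
    by near=> y; rewrite wedge_ge//; apply: ltW; near: y; exact: lt_nbhsr.
  by rewrite derive_cst mulr0 subr0.
Unshelve. all: by end_near. Qed.

(** Cut off outside (0, 1) so that integrals can be taken over the whole line. *)
Definition daughter_mass (R : realType) (beta : R -> R) (z : R) : R :=
  if 0 < z < 1 then z * beta z else 0.

(** The mean of [max 0 (b - y)] over the sizes [y = x z] of the daughters of a
    particle of size [x], weighted by mass. *)
Definition mean_gap (R : realType) (J : R -> R) (b x : R) : R :=
  \int[@lebesgue_measure R]_z (J z * Num.max 0 (b - x * z)).

Section daughters.
Context (R : realType).
Local Notation mu := (@lebesgue_measure R).
Variable beta : R -> R.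
Hypotheses (beta_meas : measurable_fun (`]0, 1[ : set R) beta)
  (beta_ge0 : forall z : R, 0 < z < 1 -> 0 <= beta z)
  (beta_mass : (\int[mu]_(z in `]0%R, 1%R[) (z * beta z)%:E = 1)%E).
Local Notation J := (daughter_mass beta).

Lemma daughter_mass_ge0 z : 0 <= J z.
Proof.
rewrite /daughter_mass; case: ifP => // z01.
by rewrite mulr_ge0 ?beta_ge0// ltW//; case/andP: z01.
Qed.

Lemma daughter_mass_support z : J z != 0 -> 0 < z < 1.
Proof. by rewrite /daughter_mass; case: ifP => //; rewrite eqxx. Qed.

Lemma measurable_daughter_mass : measurable_fun setT J.
Proof.
have -> : J = (fun z => z * beta z) \_ `]0, 1[%classic.
  apply/funext => z; rewrite patchE /daughter_mass.
  by rewrite mem_setE in_itv.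
apply: (measurable_restrictT _ _).1 => //; apply: measurable_funM => //.
Qed.

Lemma integral_daughter_mass : (\int[mu]_z (J z)%:E = 1)%E.
Proof.
rewrite -beta_mass [RHS]integral_mkcond; apply: eq_integral => z _.
rewrite patchE /daughter_mass.
by rewrite mem_setE in_itv/=; case: ifP.
Qed.

Let iJ : mu.-integrable setT (EFin \o J).
Proof.
apply/integrableP; split; first by apply/measurable_EFinP; exact: measurable_daughter_mass.
under eq_integral do rewrite /= ger0_norm ?daughter_mass_ge0//.
by rewrite integral_daughter_mass ltry.
Qed.

Lemma integrable_gap (b x : R) : 0 <= b -> 0 <= x ->
  mu.-integrable setT (EFin \o (fun z => J z * Num.max 0 (b - x * z))).
Proof.
move=> b0 x0; apply: (le_integrable measurableT _ _ (integrableZl measurableT b iJ)).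
  apply/measurable_EFinP; apply: measurable_funM; first exact: measurable_daughter_mass.
  apply: measurable_maxr => //; apply: measurable_funB => //; exact: mulrl_measurable.
move=> z _ /=; rewrite lee_fin.
have [->|/daughter_mass_support/andP[z0 z1]] := eqVneq (J z) 0.
  by rewrite mul0r normr0 normr_ge0.
rewrite mulrC normrM normrM ler_wpM2r// ger0_norm; last by rewrite le_max lexx.
have xz : 0 <= x * z by rewrite mulr_ge0// ltW.
by rewrite ger0_norm// ge_max b0/= lerBlDr lerDl.
Qed.

Lemma EFin_mean_gap (b x : R) : 0 <= b -> 0 <= x ->
  ((mean_gap J b x)%:E = \int[mu]_z (J z * Num.max 0 (b - x * z))%:E)%E.
Proof.
move=> b0 x0; rewrite /mean_gap /Rintegral fineK//.
exact: (integrable_fin_num measurableT (integrable_gap b0 x0)).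
Qed.

Lemma mean_gap_ge0 (b x : R) : 0 <= mean_gap J b x.
Proof.
apply: Rintegral_ge0 => z _; rewrite mulr_ge0 ?daughter_mass_ge0//.
by rewrite le_max lexx.
Qed.

Lemma mean_gap_le (b x : R) : 0 <= b -> 0 <= x -> mean_gap J b x <= b.
Proof.
move=> b0 x0; rewrite -lee_fin EFin_mean_gap//.
rewrite -[leRHS]mule1 -integral_daughter_mass -ge0_integralZl//=; last 2 first.
- by apply/measurable_EFinP; exact: measurable_daughter_mass.
- by move=> z _; rewrite lee_fin daughter_mass_ge0.
apply: ge0_le_integral => //=.
- by move=> z _; rewrite lee_fin mulr_ge0 ?daughter_mass_ge0// le_max lexx.
- by have /integrableP[] := integrable_gap b0 x0.
- by apply/measurable_EFinP; apply: measurable_funM => //; exact: measurable_daughter_mass.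
move=> z _; rewrite lee_fin.
have [->|/daughter_mass_support/andP[z0 z1]] := eqVneq (J z) 0.
  by rewrite mul0r mulr0.
rewrite mulrC ler_wpM2r ?daughter_mass_ge0// ge_max b0/= lerBlDr lerDl.
by rewrite mulr_ge0// ltW.
Qed.

Lemma measurable_mean_gap (b : R) : measurable_fun setT (mean_gap J b).
Proof.
apply: (measurableT_comp (f := fine)) => //.
apply: (measurable_fun_fubini_tonelli_F (m2 := mu)
  (fun p : measurableTypeR R * measurableTypeR R =>
    (J p.2 * Num.max 0 (b - p.1 * p.2))%:E)).
  apply/measurable_EFinP; apply: measurable_funM.
    by apply: measurableT_comp => //; exact: measurable_daughter_mass.
  by apply: measurable_maxr => //; apply: measurable_funB => //; exact: measurable_funM.
move=> p; rewrite lee_fin mulr_ge0 ?daughter_mass_ge0//.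
by rewrite le_max lexx.
Qed.

Lemma daughters_wedgeE (b x z : R) : 0 < x ->
  wedge b z * (x^-1 * beta (z / x) * \1_(`]0%R, x[%classic) z) =
  x^-1 * (x * (J (z / x) * Num.max 0 (b - x * (z / x)))).
Proof.
move=> x0.
rewrite mulKf ?gt_eqF// /daughter_mass indicE mem_setE in_itv/=.
rewrite pmulr_lgt0 ?invr_gt0// ltr_pdivrMr// mul1r.
case: ifP => _; last by rewrite !mulr0 mul0r.
rewrite mulr1.
have -> : x * (z / x) = z by rewrite mulrC divfK ?gt_eqF.
by rewrite /wedge; ring.
Qed.

(** Rescaling by the size [x] of the parent turns the daughters into the
    relative sizes distributed by [beta]. *)
Lemma integral_daughters_wedge (b x : R) : 0 <= b -> 0 < x ->
  (\int[mu]_z (wedge b z * (x^-1 * beta (z / x) * \1_(`]0%R, x[%classic) z))%:E =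
   (x * mean_gap J b x)%:E)%E.
Proof.
move=> b0 x0; pose h u := x * (J u * Num.max 0 (b - x * u)).
transitivity (\int[mu]_z (x^-1 * h (z / x))%:E)%E.
  by apply: eq_integral => z _; rewrite daughters_wedgeE.
rewrite ge0_integral_dilation//; last 2 first.
- apply: measurable_funM => //.
  by apply/measurable_EFinP; have /integrableP[] := integrable_gap b0 (ltW x0).
- by move=> u; rewrite !mulr_ge0 ?daughter_mass_ge0 ?(ltW x0)// le_max lexx.
rewrite EFinM EFin_mean_gap// ?(ltW x0)// -ge0_integralZl//=.
- by have /integrableP[] := integrable_gap b0 (ltW x0).
- by move=> z _; rewrite lee_fin mulr_ge0 ?daughter_mass_ge0// le_max lexx.
- by rewrite lee_fin ltW.
Qed.

(** Each of the two colliding particles breaks independently of the other, so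
    the defect is a sum of a function of [x] and a function of [y]. *)
Lemma breakage_defect_wedge (b x y : R) : 0 <= b -> 0 < x -> 0 < y ->
  breakage_defect (breakage_function beta) (wedge b) x y =
  x * (mean_gap J b x - Num.max 0 (b - x)) +
  y * (mean_gap J b y - Num.max 0 (b - y)).
Proof.
move=> b0 x0 y0; rewrite /breakage_defect.
pose G (x z : R) := wedge b z * (x^-1 * beta (z / x) * \1_(`]0, x[%classic) z).
have GE (t : R) : 0 < t -> (\int[mu]_z (G t z)%:E = (t * mean_gap J b t)%:E)%E.
  by move=> t0; exact: integral_daughters_wedge.
have Gform (t z : R) : 0 < t ->
    G t z = t^-1 * (t * (J (z / t) * Num.max 0 (b - t * (z / t)))).
  exact: daughters_wedgeE.
have G0 (t z : R) : 0 < t -> 0 <= G t z.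
  move=> t0; rewrite Gform// mulr_ge0 ?invr_ge0 ?(ltW t0)//.
  by rewrite !mulr_ge0 ?(ltW t0) ?daughter_mass_ge0// le_max lexx.
have mG (t : R) : 0 < t -> measurable_fun setT (EFin \o G t).
  move=> t0; apply/measurable_EFinP.
  rewrite (_ : G t = fun z => t^-1 * (t * (J (z / t) * Num.max 0 (b - t * (z / t)))));
    last by apply/funext => z; exact: Gform.
  have mdiv : measurable_fun setT (fun z : R => z / t) by exact: mulrr_measurable.
  apply: measurable_funM => //; apply: measurable_funM => //.
  apply: measurable_funM; first exact: (measurableT_comp measurable_daughter_mass).
  by apply: measurable_maxr => //; apply: measurable_funB => //; exact: measurable_funM.
have -> : \int[mu]_(z in `]0, x + y[) (wedge b z * breakage_function beta z x y) =
    x * mean_gap J b x + y * mean_gap J b y.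
  rewrite /Rintegral.
  have -> : (\int[mu]_(z in `]0%R, (x + y)%R[)
      (wedge b z * breakage_function beta z x y)%:E =
      \int[mu]_z ((G x z)%:E + (G y z)%:E))%E.
    rewrite integral_mkcond; apply: eq_integral => z _.
    rewrite patchE mem_setE in_itv/= -EFinD -mulrDr; case: ifPn => // zxy.
    rewrite !indicE !mem_setE !in_itv/=.
    have -> : (0 < z < x) = false.
      by apply: contraNF zxy => /andP[-> zx]; rewrite (lt_trans zx)// ltrDl.
    have -> : (0 < z < y) = false.
      by apply: contraNF zxy => /andP[-> zx]; rewrite (lt_trans zx)// ltrDr.
    by rewrite !mulr0 addr0 mulr0.
  rewrite ge0_integralD//=.
  - by rewrite GE// GE.
  - by move=> z _; rewrite lee_fin G0.
  - exact: mG.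
  - by move=> z _; rewrite lee_fin G0.
  - exact: mG.
rewrite /wedge; ring.
Qed.

End daughters.

(** * The weak formulation tested with wedges *)

Lemma Rintegral_lin4 (R : realType) (D : set R) (u1 u2 u3 u4 : R -> R)
    (c1 c2 c3 c4 : R) :
  measurable D ->
  (@lebesgue_measure R).-integrable D (EFin \o u1) ->
  (@lebesgue_measure R).-integrable D (EFin \o u2) ->
  (@lebesgue_measure R).-integrable D (EFin \o u3) ->
  (@lebesgue_measure R).-integrable D (EFin \o u4) ->
  \int[@lebesgue_measure R]_(x in D) (c1 * u1 x + c2 * u2 x + c3 * u3 x + c4 * u4 x) =
  c1 * (\int[@lebesgue_measure R]_(x in D) u1 x) +
  c2 * (\int[@lebesgue_measure R]_(x in D) u2 x) +
  c3 * (\int[@lebesgue_measure R]_(x in D) u3 x) +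
  c4 * (\int[@lebesgue_measure R]_(x in D) u4 x).
Proof.
move=> mD i1 i2 i3 i4.
have iZ (c : R) (u : R -> R) : (@lebesgue_measure R).-integrable D (EFin \o u) ->
    (@lebesgue_measure R).-integrable D (EFin \o (fun x => c * u x)).
  exact: integrableZl.
have iD (u v : R -> R) : (@lebesgue_measure R).-integrable D (EFin \o u) ->
    (@lebesgue_measure R).-integrable D (EFin \o v) ->
    (@lebesgue_measure R).-integrable D (EFin \o (fun x => u x + v x)).
  exact: integrableD.
have j1 := iZ c1 _ i1; have j2 := iZ c2 _ i2.
have j3 := iZ c3 _ i3; have j4 := iZ c4 _ i4.
have mD' : measurable (D : set (measurableTypeR R)) := mD.
have j12 := iD _ _ j1 j2; have j123 := iD _ _ j12 j3.
rewrite (RintegralD mD' j123 j4) (RintegralD mD' j12 j3) (RintegralD mD' j1 j2).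
by rewrite !RintegralZl.
Qed.

Lemma measurable_ltb (R : realType) (b : R) :
  measurable_fun setT (fun x : R => (x < b)%R%:R : R).
Proof.
rewrite (_ : (fun x : R => (x < b)%R%:R) = (\1_(`]-oo, b[%classic) : R -> R)).
  exact: measurable_indic.
by apply/funext => x; rewrite indicE mem_setE in_itv.
Qed.

Section weak_form.
Context (R : realType).
Local Notation mu := (@lebesgue_measure R).
Local Notation D := (`]0, +oo[%classic : set R).
Variables (beta eta : R -> R) (l1 l2 : R).
Hypotheses (l1_gt0 : 0 < l1) (l1_le_l2 : l1 <= l2) (l2_le1 : l2 <= 1).
Hypotheses (beta_meas : measurable_fun (`]0, 1[ : set R) beta)
  (beta_ge0 : forall z : R, 0 < z < 1 -> 0 <= beta z)
  (beta_mass : (\int[mu]_(z in `]0%R, 1%R[) (z * beta z)%:E = 1)%E).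
Hypotheses (eta_ge0 : {ae mu, forall x : R, 0 < x -> 0 <= eta x})
  (eta_l1 : weighted_L1 l1 eta) (eta_l2 : weighted_L1 (1 + l2) eta).
Local Notation J := (daughter_mass beta).
Local Notation gap b x := (Num.max 0 (b - x)).

Lemma measurable_profile : measurable_fun D eta.
Proof.
have m1 : measurable_fun D (fun x => x `^ (- l1) * (x `^ l1 * eta x)).
  apply: measurable_funM; first exact: measurable_funTS.
  by apply/measurable_EFinP; case/integrableP : eta_l1.
apply: eq_measurable_fun m1 => x; rewrite inE/= in_itv/= andbT => x0.
by rewrite powRN mulKf// gt_eqF// powR_gt0.
Qed.

(** [x^r <= x^l1 + x^(1 + l2)] for the intermediate exponents. *)
Lemma integrable_weighted (r : R) : l1 <= r -> r <= 1 + l2 ->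
  mu.-integrable D (EFin \o (fun x => x `^ r * eta x)).
Proof.
move=> l1r rl2.
apply: (le_integrable _ _ _
  (integrableD _ (integrable_norm eta_l1) (integrable_norm eta_l2))) => //.
  apply/measurable_EFinP; apply: measurable_funM; last exact: measurable_profile.
  exact: measurable_funTS.
move=> x; rewrite /= in_itv/= andbT => x0; rewrite lee_fin.
rewrite (ger0_norm (_ : 0 <= `|_| + `|_|)) ?addr_ge0// !normrM -mulrDl ler_wpM2r//.
rewrite !ger0_norm ?powR_ge0//.
have [x1|/ltW x1] := leP 1 x.
  by rewrite (le_trans (ler_powR x1 rl2))// lerDr powR_ge0.
rewrite (@le_trans _ _ (x `^ l1)) ?lerDl ?powR_ge0//.
by apply: ger_powR => //; rewrite x0.
Qed.

(** A version of the profile that is nonnegative everywhere and vanishes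
    off (0, +oo), as needed to apply Tonelli on the whole line. *)
Definition profile_part (x : R) : R := if 0 < x then Num.max 0 (eta x) else 0.
Local Notation eta0 := profile_part.

Lemma profile_part_ge0 (x : R) : 0 <= eta0 x.
Proof. by rewrite /profile_part; case: ifP => // _; rewrite le_max lexx. Qed.

Lemma profile_part_support (x : R) : eta0 x != 0 -> 0 < x.
Proof. by rewrite /profile_part; case: ifP => //; rewrite eqxx. Qed.

Lemma ae_profile_part : {ae mu, forall x : R, 0 < x -> eta0 x = eta x}.
Proof.
apply: ae_lebesgueS eta_ge0 => x ex x0.
by rewrite /profile_part x0 max_r// ex.
Qed.

Lemma profile_part_restrict : eta0 = (fun x => Num.max 0 (eta x)) \_ D.
Proof.
by apply/funext => x; rewrite patchE mem_setE in_itv/= andbT.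
Qed.

Lemma measurable_profile_part : measurable_fun setT eta0.
Proof.
rewrite profile_part_restrict; apply: (measurable_restrictT _ _).1 => //.
by apply: measurable_maxr => //; exact: measurable_profile.
Qed.

Lemma Rintegral_profile_part (F : R -> R) : measurable_fun D F ->
  \int[mu]_(x in D) (F x * eta x) = \int[mu]_x (F x * eta0 x).
Proof.
move=> mF; transitivity (\int[mu]_(x in D) (F x * eta0 x)).
  congr fine; apply: ae_eq_integral => //.
  - apply/measurable_EFinP; apply: measurable_funM => //; exact: measurable_profile.
  - apply/measurable_EFinP; apply: measurable_funM => //; apply: measurable_funTS.
    exact: measurable_profile_part.
  - apply: ae_lebesgueS ae_profile_part => x ex; rewrite /= in_itv/= andbT => x0.
    by rewrite ex.
rewrite Rintegral_mkcond; apply: eq_Rintegral => x _.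
rewrite patchE mem_setE in_itv/= andbT; case: ifPn => // x0.
by rewrite /profile_part (negbTE x0) mulr0.
Qed.

Lemma moment_profileE (r : R) : moment r eta = \int[mu]_x (x `^ r * eta0 x).
Proof. by apply: Rintegral_profile_part; exact: measurable_funTS. Qed.

Lemma moment_profile_ge0 (r : R) : 0 <= moment r eta.
Proof.
rewrite moment_profileE; apply: Rintegral_ge0 => x _.
by rewrite mulr_ge0 ?powR_ge0 ?profile_part_ge0.
Qed.

Lemma integrable_profile_part (r : R) : l1 <= r -> r <= 1 + l2 ->
  mu.-integrable setT (EFin \o (fun x => x `^ r * eta0 x)).
Proof.
move=> l1r rl2.
have iD : mu.-integrable D (EFin \o (fun x => x `^ r * eta0 x)).
  apply: (le_integrable _ _ _ (integrable_weighted l1r rl2)) => //.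
    apply/measurable_EFinP; apply: measurable_funTS.
    by apply: measurable_funM => //; exact: measurable_profile_part.
  move=> x; rewrite /= in_itv/= andbT => x0; rewrite lee_fin.
  rewrite (normrM (x `^ r) (eta0 x)) (normrM (x `^ r) (eta x)) ler_wpM2l//.
  rewrite /profile_part x0; case: (leP 0 (eta x)) => // _.
  by rewrite normr0.
have -> : EFin \o (fun x => x `^ r * eta0 x) =
    (EFin \o (fun x => x `^ r * eta0 x)) \_ D.
  apply/funext => x; rewrite patchE mem_setE in_itv/= andbT; case: ifPn => // x0.
  by rewrite /= /profile_part (negbTE x0) mulr0.
by rewrite -integrable_mkcond.
Qed.

(** This is alpha times the integral of [collision_kernel l1 l2 x] against
    [eta]; the symmetry of the kernel absorbs the factor 1/2 of the weak
    formulation. *)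
Definition collision_rate (x : R) : R :=
  (l1 + l2 - 1) * (moment l2 eta * x `^ l1 + moment l1 eta * x `^ l2).

Definition collided_mass (x : R) : R := x * collision_rate x * eta0 x.

(** The contribution of one particle of size [x] to the defect of [wedge b]. *)
Definition mass_gain (b x : R) : R := x * (mean_gap J b x - gap b x).

Let gap_ge0 (b x : R) : 0 <= gap b x. Proof. by rewrite le_max lexx. Qed.
Let gap_le (b x : R) : 0 <= b -> 0 <= x -> gap b x <= b.
Proof. by move=> b0 x0; rewrite ge_max b0/= lerBlDr lerDl. Qed.

Let measurable_gap (b : R) : measurable_fun setT (fun x : R => gap b x).
Proof. by apply: measurable_maxr => //; exact: measurable_funB. Qed.

Lemma measurable_mass_gain (b : R) : measurable_fun setT (mass_gain b).
Proof.
apply: measurable_funM => //; apply: measurable_funB => //.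
exact: (measurable_mean_gap beta_meas beta_ge0).
Qed.

(** Both the gap and its mean over the daughters lie between 0 and [b]. *)
Lemma mass_gain_le (b x : R) : 0 <= b -> 0 <= x -> `|mass_gain b x| <= b * x.
Proof.
move=> b0 x0; rewrite /mass_gain normrM (ger0_norm x0) mulrC ler_wpM2r//.
have := mean_gap_le beta_meas beta_ge0 beta_mass b0 x0.
have := mean_gap_ge0 beta_ge0 b x.
have := gap_ge0 b x; have := gap_le b0 x0.
by move=> ? ? ? ?; rewrite ler_norml; apply/andP; split; lra.
Qed.

Lemma integrable_mass_gain (b r : R) : 0 <= b -> l1 <= r -> r <= l2 ->
  mu.-integrable D (EFin \o (fun x => x `^ r * (mass_gain b x * eta x))).
Proof.
move=> b0 l1r rl2.
have i1 : mu.-integrable D (EFin \o (fun x => x `^ (1 + r) * eta x)).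
  by apply: integrable_weighted; lra.
apply: (le_integrable _ _ _ (integrableZl _ b i1)) => //.
  apply/measurable_EFinP; apply: measurable_funM; first exact: measurable_funTS.
  apply: measurable_funM; last exact: measurable_profile.
  by apply: measurable_funTS; exact: measurable_mass_gain.
move=> x; rewrite /= in_itv/= andbT => x0; rewrite lee_fin.
rewrite [leLHS]normrM (normrM (mass_gain b x)) [leRHS]normrM (normrM (x `^ (1 + r))).
rewrite (ger0_norm b0) !(ger0_norm (powR_ge0 _ _)).
rewrite powRD; last by rewrite (gt_eqF x0) implybT.
rewrite powRr1 ?(ltW x0)//.
rewrite (_ : b * (x * x `^ r * `|eta x|) = x `^ r * (b * x * `|eta x|)); last by ring.
rewrite ler_wpM2l ?powR_ge0// ler_wpM2r//.
exact: mass_gain_le (ltW x0).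
Qed.

Let Q (b r : R) := \int[mu]_(x in D) (x `^ r * (mass_gain b x * eta x)).

(** The integrand is a sum of products of a function of [x] and a function of
    [y]. Both iterated integrals are therefore linear combinations of the same
    four functions, the profile and its mass gain with weights of order [l1]
    and [l2]; each product occurs twice, with the particles exchanged. *)
Lemma double_integral_wedge (b : R) : 0 <= b ->
  \int[mu]_(x in D) \int[mu]_(y in D)
    (breakage_defect (breakage_function beta) (wedge b) x y *
     collision_kernel l1 l2 x y * eta x * eta y) =
  2 * (moment l2 eta * Q b l1 + moment l1 eta * Q b l2).
Proof.
move=> b0; pose M1 := moment l1 eta; pose M2 := moment l2 eta.
have iu1 : mu.-integrable D (EFin \o (fun x => x `^ l1 * eta x)) by [].
have iu2 : mu.-integrable D (EFin \o (fun x => x `^ l2 * eta x)).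
  by apply: integrable_weighted => //; rewrite lerDr.
have iv1 := integrable_mass_gain b0 (lexx l1) l1_le_l2.
have iv2 := integrable_mass_gain b0 l1_le_l2 (lexx l2).
transitivity (\int[mu]_(x in D)
   (M2 * (x `^ l1 * (mass_gain b x * eta x)) +
    M1 * (x `^ l2 * (mass_gain b x * eta x)) +
    Q b l2 * (x `^ l1 * eta x) + Q b l1 * (x `^ l2 * eta x))).
  apply: eq_Rintegral => x; rewrite inE/= in_itv/= andbT => x0.
  transitivity (\int[mu]_(y in D)
    ((eta x * mass_gain b x * x `^ l1) * (y `^ l2 * eta y) +
     (eta x * mass_gain b x * x `^ l2) * (y `^ l1 * eta y) +
     (eta x * x `^ l1) * (y `^ l2 * (mass_gain b y * eta y)) +
     (eta x * x `^ l2) * (y `^ l1 * (mass_gain b y * eta y)))).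
    apply: eq_Rintegral => y; rewrite inE/= in_itv/= andbT => y0.
    rewrite breakage_defect_wedge// -/(mass_gain b x) -/(mass_gain b y).
    rewrite /collision_kernel.
    ring.
  rewrite Rintegral_lin4// -/(Q b l1) -/(Q b l2) -/(moment l1 eta) -/(moment l2 eta).
  rewrite /M1 /M2; ring.
rewrite Rintegral_lin4// -/(Q b l1) -/(Q b l2) -/(moment l1 eta) -/(moment l2 eta).
rewrite /M1 /M2; ring.
Qed.

(** The kink [b] of the wedge, left out by [wedge_flux], is removed from the
    domain of integration: the integrand takes a default value there. *)
Lemma flux_integral_wedge (b : R) :
  \int[mu]_(x in D) ((wedge b x - x * derive1 (wedge b) x) * eta x) =
  \int[mu]_x (x ^+ 2 * eta0 x * (x < b)%R%:R).
Proof.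
transitivity (\int[mu]_(x in D) (x ^+ 2 * (x < b)%R%:R * eta x)).
  have mF : measurable_fun D (fun x : R => x ^+ 2 * (x < b)%R%:R * eta x).
    apply: measurable_funM; last exact: measurable_profile.
    by apply: measurable_funTS; apply: measurable_funM => //; exact: measurable_ltb.
  have eqDb (x : R) : x \in (D `\ b) ->
      ((wedge b x - x * derive1 (wedge b) x) * eta x)%:E =
      (x ^+ 2 * (x < b)%R%:R * eta x)%:E.
    by rewrite inE => -[_ /= xb]; rewrite wedge_flux//; apply/eqP.
  have mFb : measurable_fun (D `\ b) (fun x : R => (x ^+ 2 * (x < b)%R%:R * eta x)%:E).
    apply/measurable_EFinP; apply: measurable_funS mF => //; exact: subDsetl.
  rewrite /Rintegral; congr fine.
  rewrite -[LHS](@integral_setD1 _ _ b); last 2 first.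
  - exact: measurableD.
  - by apply: eq_measurable_fun mFb => x xD; rewrite eqDb.
  rewrite -[RHS](@integral_setD1 _ _ b); last 2 first.
  - exact: measurableD.
  - exact: mFb.
  by apply: eq_integral => x /eqDb.
rewrite Rintegral_profile_part.
  by apply: eq_Rintegral => x _; rewrite mulrAC.
by apply: measurable_funTS; apply: measurable_funM => //; exact: measurable_ltb.
Qed.

Lemma collision_rate_ge0 (x : R) : 1 < l1 + l2 -> 0 <= collision_rate x.
Proof.
move=> l12_gt1; rewrite /collision_rate mulr_ge0//; first lra.
by rewrite addr_ge0// mulr_ge0 ?powR_ge0 ?moment_profile_ge0.
Qed.

Lemma measurable_collision_rate : measurable_fun setT collision_rate.
Proof.
by apply: measurable_funM => //; apply: measurable_funD; apply: measurable_funM.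
Qed.

Lemma collided_mass_ge0 (x : R) : 1 < l1 + l2 -> 0 <= collided_mass x.
Proof.
move=> l12_gt1; rewrite /collided_mass.
have [->|/profile_part_support x0] := eqVneq (eta0 x) 0; first by rewrite mulr0.
apply: mulr_ge0; last exact: profile_part_ge0.
by rewrite mulr_ge0 ?(ltW x0)// collision_rate_ge0.
Qed.

Lemma collided_mass_support (x : R) : collided_mass x != 0 -> 0 < x.
Proof.
by rewrite /collided_mass !mulf_eq0 !negb_or => /andP[_ /profile_part_support].
Qed.

Lemma integrable_collided_mass : mu.-integrable setT (EFin \o collided_mass).
Proof.
pose c1 := (l1 + l2 - 1) * moment l2 eta; pose c2 := (l1 + l2 - 1) * moment l1 eta.
have i1 : mu.-integrable setT (EFin \o (fun x => x `^ (1 + l1) * eta0 x)).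
  by apply: integrable_profile_part; [rewrite lerDr|rewrite lerD2l].
have i2 : mu.-integrable setT (EFin \o (fun x => x `^ (1 + l2) * eta0 x)).
  by apply: integrable_profile_part => //; rewrite (le_trans l1_le_l2)// lerDr.
have -> : collided_mass =
    (fun x => c1 * (x `^ (1 + l1) * eta0 x) + c2 * (x `^ (1 + l2) * eta0 x)).
  apply/funext => x.
  have [e0|/profile_part_support x0] := eqVneq (eta0 x) 0.
    by rewrite /collided_mass e0 !mulr0 addr0.
  rewrite !powRD ?(gt_eqF x0) ?implybT// powRr1 ?(ltW x0)//.
  by rewrite /collided_mass /c1 /c2 /collision_rate; ring.
exact: (integrableD measurableT (integrableZl measurableT c1 i1)
  (integrableZl measurableT c2 i2)).
Qed.

Lemma weak_form_wedge (b : R) : 1 < l1 + l2 ->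
  self_similar_profile l1 l2 (collision_kernel l1 l2) (breakage_function beta) eta ->
  0 <= b ->
  \int[mu]_x (x ^+ 2 * eta0 x * (x < b)%R%:R) =
  \int[mu]_x (collided_mass x * (mean_gap J b x - gap b x)).
Proof.
move=> l12_gt1 [_ _ _ /(_ _ (test_function_wedge b)) weak] b0.
rewrite -flux_integral_wedge weak double_integral_wedge//.
transitivity (\int[mu]_(x in D) (collision_rate x * mass_gain b x * eta x)).
  have iv1 := integrable_mass_gain b0 (lexx l1) l1_le_l2.
  have iv2 := integrable_mass_gain b0 l1_le_l2 (lexx l2).
  transitivity (\int[mu]_(x in D)
    (((l1 + l2 - 1) * moment l2 eta) * (x `^ l1 * (mass_gain b x * eta x)) +
     ((l1 + l2 - 1) * moment l1 eta) * (x `^ l2 * (mass_gain b x * eta x)) +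
     0 * (x `^ l1 * (mass_gain b x * eta x)) +
     0 * (x `^ l1 * (mass_gain b x * eta x)))).
    rewrite Rintegral_lin4// -/(Q b l1) -/(Q b l2); by field.
  by apply: eq_Rintegral => x _; rewrite /collision_rate; ring.
rewrite Rintegral_profile_part; last first.
  apply: measurable_funTS; apply: measurable_funM.
    exact: measurable_collision_rate.
  exact: measurable_mass_gain.
by apply: eq_Rintegral => x _; rewrite /collided_mass /mass_gain; ring.
Qed.

(** The weak formulation in a form where every term is nonnegative, as
    Tonelli requires. *)
Lemma mass_equation (b : R) : 1 < l1 + l2 ->
  self_similar_profile l1 l2 (collision_kernel l1 l2) (breakage_function beta) eta ->
  0 < b ->
  (\int[mu]_x (x ^+ 2 * eta0 x * (x < b)%R%:R)%:E +
   \int[mu]_x (collided_mass x * gap b x)%:E =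
   \int[mu]_x \int[mu]_z (collided_mass x * J z * gap b (x * z))%:E)%E.
Proof.
move=> l12_gt1 prof b_gt0; have b0 := ltW b_gt0.
have bndK (p : R -> R) : measurable_fun setT p ->
    (forall x : R, 0 < x -> 0 <= p x <= b) ->
    mu.-integrable setT (EFin \o (fun x => collided_mass x * p x)).
  move=> mp p0b.
  apply: (le_integrable measurableT _ _
    (integrableZl measurableT b integrable_collided_mass)).
    apply/measurable_EFinP; apply: measurable_funM => //.
    by apply/measurable_EFinP; case/integrableP : integrable_collided_mass.
  move=> x _ /=; rewrite lee_fin mulrC.
  have [->|/collided_mass_support/p0b/andP[p0 pb]] := eqVneq (collided_mass x) 0.
    by rewrite !mulr0.
  by rewrite [leLHS]normrM (normrM b) ler_wpM2r// ger0_norm// ger0_norm.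
have ig : mu.-integrable setT (EFin \o (fun x => collided_mass x * gap b x)).
  apply: bndK => // x x0; rewrite gap_ge0/= gap_le// ltW//.
have im : mu.-integrable setT (EFin \o (fun x => collided_mass x * mean_gap J b x)).
  apply: bndK; first exact: measurable_mean_gap.
  by move=> x x0; rewrite mean_gap_ge0//= mean_gap_le// ltW.
have iw : mu.-integrable setT (EFin \o (fun x => x ^+ 2 * eta0 x * (x < b)%R%:R)).
  have i1 : mu.-integrable setT (EFin \o (fun x => x `^ 1 * eta0 x)).
    apply: integrable_profile_part; first exact: le_trans l2_le1.
    by rewrite lerDl (le_trans (ltW l1_gt0)).
  apply: (le_integrable measurableT _ _ (integrableZl measurableT b i1)).
    apply/measurable_EFinP; apply: measurable_funM.
      by apply: measurable_funM => //; exact: measurable_profile_part.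
    exact: measurable_ltb.
  move=> x _ /=; rewrite lee_fin.
  have [->|/profile_part_support x0] := eqVneq (eta0 x) 0.
    by rewrite !(mulr0, mul0r).
  case: (ltP x b) => xb; last by rewrite mulr0 normr0.
  rewrite mulr1 powRr1 ?(ltW x0)// expr2 -mulrA mulrA (mulrA b).
  rewrite (normrM (x * x)) (normrM (b * x)) ler_wpM2r//.
  by rewrite !ger0_norm ?mulr_ge0 ?(ltW x0)// ler_wpM2r// ltW.
have -> : (\int[mu]_x \int[mu]_z (collided_mass x * J z * gap b (x * z))%:E =
    \int[mu]_x (collided_mass x * mean_gap J b x)%:E)%E.
  apply: eq_integral => x _.
  have [->|/collided_mass_support x0] := eqVneq (collided_mass x) 0.
    by rewrite mul0r integral0_eq// => z _; rewrite !mul0r.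
  rewrite EFinM EFin_mean_gap// ?(ltW x0)// -ge0_integralZl//=; last 3 first.
  - by have /integrableP[] := integrable_gap beta_meas beta_ge0 beta_mass b0 (ltW x0).
  - by move=> z _; rewrite lee_fin mulr_ge0 ?daughter_mass_ge0.
  - by rewrite lee_fin collided_mass_ge0.
  by apply: eq_integral => z _; rewrite -EFinM mulrA.
have fin (p : R -> R) : mu.-integrable setT (EFin \o p) ->
    (\int[mu]_x (p x)%:E = (\int[mu]_x p x)%:E)%E.
  by move=> ip; rewrite /Rintegral fineK//; exact: (integrable_fin_num measurableT ip).
rewrite (fin _ ig) (fin _ im) (fin _ iw) -EFinD; congr EFin.
rewrite (weak_form_wedge l12_gt1 prof b0).
transitivity (
  \int[mu]_x (collided_mass x * mean_gap J b x - collided_mass x * gap b x) +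
  \int[mu]_x (collided_mass x * gap b x)).
  by congr (_ + _); apply: eq_Rintegral => x _; rewrite mulrBr.
by rewrite RintegralB// subrK.
Qed.

End weak_form.

(** * Representation, monotonicity and positivity of the profile *)

Section profile_theory.
Context (R : realType).
Local Notation mu := (@lebesgue_measure R).
Variables (beta eta : R -> R) (l1 l2 : R).
Hypotheses (l1_le_l2 : l1 <= l2) (l2_le1 : l2 <= 1) (l12_gt1 : 1 < l1 + l2).
Hypotheses (beta_meas : measurable_fun (`]0, 1[ : set R) beta)
  (beta_ge0 : forall z : R, 0 < z < 1 -> 0 <= beta z)
  (beta_mass : (\int[mu]_(z in `]0%R, 1%R[) (z * beta z)%:E = 1)%E).
Hypothesis profile : self_similar_profile l1 l2 (collision_kernel l1 l2)
  (breakage_function beta) eta.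

Let l1_gt0 : 0 < l1.
Proof. by rewrite -(ltrD2r l2) add0r (le_lt_trans l2_le1). Qed.
Let l2_gt0 : 0 < l2. Proof. exact: lt_le_trans l1_le_l2. Qed.
Let alpha_gt0 : 0 < l1 + l2 - 1. Proof. by rewrite subr_gt0. Qed.
Let eta_ge0 : {ae mu, forall x : R, 0 < x -> 0 <= eta x}.
Proof. by case: profile. Qed.
Let eta_l1 : weighted_L1 l1 eta. Proof. by case: profile => _ []. Qed.
Let eta_l2 : weighted_L1 (1 + l2) eta. Proof. by case: profile => _ []. Qed.

Local Notation J := (daughter_mass beta).
Local Notation K := (collided_mass eta l1 l2).
Local Notation eta0 := (profile_part eta).

(** The everywhere defined function whose quotient by [x ^+ 2] is the
    continuous representative of the profile. *)
Definition square_weighted_profile (x : R) : R :=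
  fragment_mass_below K J x - mass_below K x.
Local Notation F := square_weighted_profile.

Let K0 x : 0 <= K x.
Proof. exact: (collided_mass_ge0 eta_ge0 eta_l1 x l12_gt1). Qed.
Let Kpos x : K x != 0 -> 0 < x.
Proof. exact: collided_mass_support. Qed.
Let iK : mu.-integrable setT (EFin \o K).
Proof. exact: integrable_collided_mass. Qed.
Let J0 z : 0 <= J z. Proof. exact: daughter_mass_ge0. Qed.
Let Jitv z : J z != 0 -> 0 < z < 1. Proof. exact: daughter_mass_support. Qed.
Let mJ : measurable_fun setT J. Proof. exact: measurable_daughter_mass. Qed.
Let J1 : (\int[mu]_z (J z)%:E = 1)%E. Proof. exact: integral_daughter_mass. Qed.

Lemma square_weighted_profile_ge0 (x : R) : 0 < x -> 0 <= F x.
Proof. by move=> x0; rewrite subr_ge0; exact: mass_below_le_fragment. Qed.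

Lemma square_weighted_profile_continuous (x : R) : 0 < x -> {for x, continuous F}.
Proof.
move=> x0; apply: (@continuousB _ _ _ (fragment_mass_below K J) (mass_below K)).
  exact: fragment_mass_below_continuous.
exact: mass_below_continuous.
Qed.

Lemma ae_square_weighted_profile :
  {ae mu, forall x : R, 0 < x -> x ^+ 2 * eta0 x = F x}.
Proof.
apply: (ae_profileE (w := fun x => x ^+ 2 * eta0 x)) => //.
- by move=> x; rewrite mulr_ge0 ?sqr_ge0 ?profile_part_ge0.
- by move=> x; rewrite mulf_eq0 negb_or => /andP[_ /profile_part_support].
- by apply: measurable_funM => //; exact: measurable_profile_part eta_l1.
- by move=> b b0; exact: mass_equation.
Qed.

Lemma profile_not_null : ~ {ae mu, forall x : R, 0 < x -> eta0 x = 0}.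
Proof.
move=> e0; have [_ _ m1 _] := profile.
suff : moment 1 eta = 0 by rewrite m1 => /eqP; rewrite oner_eq0.
rewrite (moment_profileE eta_ge0 eta_l1) /Rintegral.
rewrite (ae_eq_integral (cst 0%E)) ?integral0//.
  apply/measurable_EFinP; apply: measurable_funM => //.
  exact: measurable_profile_part eta_l1.
apply: ae_lebesgueS e0 => x ex _ /=.
have [->|/profile_part_support/ex ->] := eqVneq (eta0 x) 0; by rewrite mulr0.
Qed.

(** A vanishing moment would make the nonnegative profile null, against its
    unit mass. *)
Lemma moment_profile_gt0 : 0 < moment l1 eta.
Proof.
rewrite lt_neqAle (moment_profile_ge0 eta_ge0 eta_l1) andbT; apply/negP => /eqP M0.
apply: profile_not_null.
have mf : measurable_fun setT (EFin \o (fun x => x `^ l1 * eta0 x)).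
  apply/measurable_EFinP; apply: measurable_funM => //.
  exact: measurable_profile_part eta_l1.
have M0E : 0 = \int[mu]_x (x `^ l1 * eta0 x).
  by rewrite -(moment_profileE eta_ge0 eta_l1).
have iE : (\int[mu]_x `|(EFin \o (fun x => x `^ l1 * eta0 x)%R) x| = 0)%E.
  have i1 : mu.-integrable setT (EFin \o (fun x => x `^ l1 * eta0 x)).
    apply: (integrable_profile_part eta_l1 eta_l2) => //.
    by rewrite (le_trans l1_le_l2)// lerDr.
  transitivity ((\int[mu]_x (x `^ l1 * eta0 x))%R%:E)%E; last by rewrite -M0E.
  rewrite /Rintegral fineK; last exact: (integrable_fin_num measurableT i1).
  apply: eq_integral => x _; rewrite gee0_abs//= lee_fin.
  by rewrite mulr_ge0 ?powR_ge0 ?profile_part_ge0.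
have /(ae_eq_integral_abs mu measurableT mf) := iE.
apply: ae_lebesgueS => x /(_ I)/= /eqP; rewrite eqe mulf_eq0 => /orP[|/eqP//].
by move=> /eqP px x0; have := powR_gt0 l1 x0; rewrite px ltxx.
Qed.

(** The quotient of [collision_rate] by the size, written with powers so that
    its continuity and measurability are visible. *)
Let a (x : R) : R :=
  (l1 + l2 - 1) * (moment l2 eta * x `^ (l1 - 1) + moment l1 eta * x `^ (l2 - 1)).

Let aE (x : R) : 0 < x -> collision_rate eta l1 l2 x = x * a x.
Proof.
move=> x0; have E (l : R) : x `^ l = x * x `^ (l - 1).
  have := @powRD R x 1 (l - 1); rewrite (gt_eqF x0) implybT => /(_ isT).
  by rewrite addrC subrK powRr1 ?(ltW x0).
by rewrite /collision_rate /a (E l1) (E l2); ring.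
Qed.

Let ae_K : {ae mu, forall x : R, 0 < x -> K x = a x * F x}.
Proof.
apply: ae_lebesgueS ae_square_weighted_profile => x Fx x0.
by rewrite -Fx// /collided_mass aE//; ring.
Qed.

Let measurable_aF : measurable_fun setT (fun x => a x * F x).
Proof.
apply: measurable_funM.
  by apply: measurable_funM => //; apply: measurable_funD; apply: measurable_funM.
apply: measurable_funB.
  by case: (locally_integrable_fragment_mass_below K0 iK J0 mJ J1).
by case: (locally_integrable_mass_below K0 iK).
Qed.

Let mass_belowE (x : R) :
  mass_below K x = \int[mu]_(t in [set` Interval (BRight 0) (BRight x)]) (a t * F t).
Proof.
have mK : measurable_fun setT K by apply/measurable_EFinP; case/integrableP : iK.
transitivity (\int[mu]_(t in `]0, x]) K t).
  transitivity (\int[mu]_(t in `]0, x[) K t).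
    rewrite /mass_below /sublevel_integral [RHS]Rintegral_mkcond.
    apply: eq_Rintegral => t _.
    rewrite patchE mem_setE in_itv/=; case: (ltP t x) => _; rewrite ?andbF// andbT.
    by case: ifPn => // t0; apply/eqP; apply: contraNT t0 => /Kpos.
  rewrite /Rintegral integral_itv_bndo_bndc//.
  by apply/measurable_EFinP; exact: measurable_funTS.
congr fine; apply: ae_eq_integral => //.
- by apply/measurable_EFinP; exact: measurable_funTS.
- by apply/measurable_EFinP; exact: measurable_funTS.
- by apply: ae_lebesgueS ae_K => t Kt; rewrite /= in_itv/= => /andP[/Kt -> _].
Qed.

Let integrable_aF (x : R) :
  mu.-integrable [set` Interval (BRight 0) (BRight x)] (EFin \o (fun t => a t * F t)).
Proof.
apply/integrableP; split; first by apply/measurable_EFinP; exact: measurable_funTS.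
have /integrableP[_] : mu.-integrable `]0, x] (EFin \o K).
  exact: (integrableS measurableT).
apply: le_lt_trans; rewrite le_eqVlt; apply/orP; left; apply/eqP.
have mK : measurable_fun setT K by apply/measurable_EFinP; case/integrableP : iK.
apply: ae_eq_integral => //.
- by do 2 apply: measurableT_comp => //; exact: measurable_funTS.
- by do 2 apply: measurableT_comp => //; exact: measurable_funTS.
- by apply: ae_lebesgueS ae_K => t Kt; rewrite /= in_itv/= => /andP[/Kt -> _].
Qed.

(** Almost everywhere the density [K] of [mass_below K] is the product of [a]
    and [F], and the latter is continuous. *)
Lemma derivable_mass_below (x : R) : 0 < x ->
  derivable (mass_below K) x 1 /\ derive1 (mass_below K) x = a x * F x.
Proof.
move=> x0.
have -> : mass_below K =
  (fun y => \int[mu]_(t in [set` Interval (BRight 0) (BRight y)]) (a t * F t)).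
  by apply/funext => y; exact: mass_belowE.
apply: (@continuous_FTC1 _ _ (BRight 0) x (x + 1)).
- by rewrite ltrDl.
- exact: integrable_aF.
- by [].
apply: (@continuousM _ _ a F); last exact: square_weighted_profile_continuous.
have cp (l : R) : {for x, continuous (fun y : R => y `^ l)}.
  by apply: differentiable_continuous; apply/derivable1_diffP;
    apply: derivable_powR; rewrite in_itv/= x0.
apply: continuousM; first exact: cst_continuous.
by apply: continuousD; apply: continuousM => //; exact: cst_continuous.
Qed.

Lemma derivable_growth (x : R) : 0 < x ->
  is_derive x 1 (fun x => (l1 + l2 - 1) * growth_exponent l1 l2 eta x)
    ((l1 + l2 - 1) * (Num.max (moment l1 eta) (moment l2 eta) *
      (x `^ (l1 - 1) + x `^ (l2 - 1)))).
Proof.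
move=> x0; rewrite /growth_exponent.
have d1 := is_derive1_powR l1 x0; have d2 := is_derive1_powR l2 x0.
apply: is_derive_eq; rewrite /GRing.scale/=; field.
by rewrite !gt_eqF.
Qed.

(** The derivative of the exponent is the quotient [a] with both moments
    replaced by the larger one, hence at least [a]. *)
Lemma growth_monotone (s r : R) : 0 < s -> s < r ->
  expR ((l1 + l2 - 1) * growth_exponent l1 l2 eta s) * F s <=
  expR ((l1 + l2 - 1) * growth_exponent l1 l2 eta r) * F r.
Proof.
have M1 := moment_profile_ge0 eta_ge0 eta_l1 l1.
have M2 := moment_profile_ge0 eta_ge0 eta_l1 l2.
apply: (@gronwall_backward _ F (mass_below K)
  (fun x => (l1 + l2 - 1) * growth_exponent l1 l2 eta x)).
- exact: square_weighted_profile_ge0.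
- move=> x y x0 xy; rewrite !subrK.
  exact: (fragment_mass_below_le K0 iK J0 mJ J1 (ltW xy)).
- by move=> x /derivable_mass_below[].
- by move=> x /derivable_growth dg; have [] := dg.
- move=> x x0; have dg := derivable_growth x0; rewrite derive1E derive_val.
  apply: mulr_ge0; first exact: ltW.
  by apply: mulr_ge0; [rewrite le_max M1|rewrite addr_ge0 ?powR_ge0].
- move=> x x0; have [_ ->] := derivable_mass_below x0.
  have dg := derivable_growth x0; rewrite derive1E derive_val.
  rewrite ler_wpM2r ?square_weighted_profile_ge0// /a ler_wpM2l ?(ltW alpha_gt0)//.
  by rewrite mulrDr lerD// ler_wpM2r ?powR_ge0// le_max lexx ?orbT.
Qed.

Lemma square_weighted_profile_gt0 (x : R) :
  {ae mu, forall z : R, 0 < z < 1 -> 0 < beta z} -> 0 < x -> 0 < F x.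
Proof.
move=> beta_gt0 x0; rewrite lt_neqAle square_weighted_profile_ge0// andbT.
apply/negP => /eqP/esym Fx; apply: profile_not_null.
have J_gt0 : {ae mu, forall z : R, 0 < z < 1 -> 0 < J z}.
  apply: ae_lebesgueS beta_gt0 => z bz z01.
  by rewrite /daughter_mass z01 mulr_gt0 ?bz//; case/andP: z01.
have above := ae_eq0_above K0 Kpos iK J0 Jitv mJ J1 J_gt0 x0 (subr0_eq Fx).
apply: ae_lebesgueS2 above ae_square_weighted_profile => y Ky wy y0.
have [xy|yx] := leP x y.
  have rate_gt0 : 0 < collision_rate eta l1 l2 y.
    rewrite /collision_rate mulr_gt0// ltr_wpDl//.
      by rewrite mulr_ge0 ?powR_ge0// (moment_profile_ge0 eta_ge0 eta_l1).
    by rewrite mulr_gt0 ?powR_gt0// moment_profile_gt0.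
  have /eqP := Ky xy; rewrite /collided_mass mulf_eq0 (gt_eqF (mulr_gt0 y0 rate_gt0))/=.
  by move=> /eqP.
have := growth_monotone y0 yx; rewrite Fx mulr0 pmulr_rle0 ?expR_gt0// => Fy.
have F0 : F y = 0 by apply/eqP; rewrite eq_le Fy square_weighted_profile_ge0.
by have /eqP := wy y0; rewrite F0 mulf_eq0 sqrf_eq0 gt_eqF//= => /eqP.
Qed.

End profile_theory.

Unset Implicit Arguments.
Set Strict Implicit.

Theorem theorem2p5 (R : realType) (k0 lambda1 lambda2 : R)
    (beta eta : R -> R)
    (k0_ge0 : 0 <= k0) (k0_lt1 : k0 < 1)
    (k0_le_lambda1 : k0 <= lambda1) (lambda1_le_lambda2 : lambda1 <= lambda2)
    (lambda2_le1 : lambda2 <= 1)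
    (lambda_gt1 : 1 < lambda1 + lambda2) (lambda_le2 : lambda1 + lambda2 <= 2)
    (beta_meas : measurable_fun (`]0, 1[ : set R) beta)
    (beta_ge0 : forall z, 0 < z < 1 -> 0 <= beta z)
    (beta_mass :
      (\int[@lebesgue_measure R]_(z in `]0%R, 1%R[) (z * beta z)%:E = 1)%E)
    (beta_k0 :
      (\int[@lebesgue_measure R]_(z in `]0%R, 1%R[) (z `^ k0 * beta z)%:E
         < +oo)%E)
    (eta_profile :
      self_similar_profile lambda1 lambda2 (collision_kernel lambda1 lambda2)
        (breakage_function beta) eta)
    (beta_gt0 :
      {ae @lebesgue_measure R, forall z, 0 < z < 1 -> 0 < beta z}) :
  let alpha := lambda1 + lambda2 - 1 in
  let g := growth_exponent lambda1 lambda2 eta in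
  exists u : R -> R,
    [/\ continuous_representative eta u,
        forall x, 0 < x -> 0 < u x &
        forall xs r, 0 < xs -> xs < r ->
          r ^+ 2 * expR (alpha * g r) * u r >=
          xs ^+ 2 * expR (alpha * g xs) * u xs].
Proof.
move=> alpha g.
pose F := square_weighted_profile beta eta lambda1 lambda2.
exists (fun x => F x / x ^+ 2).
have eta_ge0 : {ae @lebesgue_measure R, forall x : R, 0 < x -> 0 <= eta x}.
  by case: eta_profile.
split=> [|x x0|s r s0 sr].
- split.
    rewrite continuous_open_subspace; last exact: interval_open.
    move=> x; rewrite inE/= in_itv/= andbT => x0.
    apply: continuousM; first exact: square_weighted_profile_continuous.
    apply: continuousV; last exact: exprn_continuous.
    by rewrite expf_neq0// gt_eqF.
  apply: (ae_lebesgueS2 _ (ae_profile_part eta_ge0)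
    (ae_square_weighted_profile lambda1_le_lambda2 lambda2_le1 lambda_gt1
      beta_meas beta_ge0 beta_mass eta_profile)) => x ex Fx x0.
  by rewrite -/F in Fx *; rewrite -Fx// ex// mulrC mulKf// expf_neq0// gt_eqF.
- by rewrite divr_gt0 ?exprn_gt0// square_weighted_profile_gt0.
- have cancel2 (t : R) : 0 < t -> t ^+ 2 * expR (alpha * g t) * (F t / t ^+ 2) =
      expR (alpha * g t) * F t.
    by move=> t0; field; rewrite gt_eqF.
  rewrite !cancel2 ?(lt_trans s0 sr)//.
  exact: growth_monotone.
Qed.
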